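(* Let $(X,\overline p)$ be a perverse space endowed with an open cover $\mathcal U$. Let $\rho_{\mathcal U}\colon\widetilde N^*_{\overline p}(X;R)\to\widetilde N^{*,\mathcal U}_{\overline p}(X;R)$ be the restriction map. Then: (i) There exist a cochain map $\varphi_{\mathcal U}\colon\widetilde N^{*,\mathcal U}_{\overline p}(X;R)\to\widetilde N^*_{\overline p}(X;R)$ and a homotopy $\Theta\colon\widetilde N^*_{\overline p}(X;R)\to\widetilde N^{*-1}_{\overline p}(X;R)$ such that $\rho_{\mathcal U}\circ\varphi_{\mathcal U}=\mathrm{id}$ and $\delta\circ\Theta+\Theta\circ\delta=\mathrm{id}-\varphi_{\mathcal U}\circ\rho_{\mathcal U}$. (ii) Furthermore, if the cochain $\omega\in\widetilde N^{*,\mathcal U}_{\overline p}(X;R)$ is such that there exists a subset $K\subset X$ for which $\omega_\sigma=0$ whenever $\operatorname{im}\sigma\cap K=\emptyset$, then $\varphi_{\mathcal U}(\omega)$ also satisfies $(\varphi_{\mathcal U}(\omega))_\sigma=0$ whenever $\operatorname{im}\sigma\cap K=\emptyset$.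
   Context: $R$ is a commutative ring with unity. Filtered spaces. A filtered space is a Hausdorff space $X$ with a filtration by closed subspaces $\emptyset=X_{-1}\subseteq X_0\subseteq\dots\subseteq X_{n-1}\subsetneq X_n=X$; $n=\dim X$ is the formal dimension. Strata are the non-empty connected components of the $X_i\setminus X_{i-1}$; a stratum $S\subset X_i\setminus X_{i-1}$ has $\operatorname{codim}S=n-i$; it is regular if $\operatorname{codim}S=0$, singular otherwise. A perversity on $X$ is a map $\overline p$ from the set of strata to $\mathbb Z\cup\{\pm\infty\}$ with value $0$ on regular strata; $(X,\overline p)$ is a perverse space. Filtered simplices. A filtered singular simplex is a continuous map $\sigma\colon\Delta\to X$ from a euclidean simplex (with ordered vertices) with a join decomposition $\Delta=\Delta_0*\dots*\Delta_n$ (some $\Delta_i$ may be empty), compatible with the vertex order, such that $\sigma^{-1}(X_i)=\Delta_0*\dots*\Delta_i$ for all $i$. It is regular if $\Delta_n\neq\emptyset$. A regular face operator is the inclusion $\delta_\ell\colon\nabla\to\Delta$ of a codimension-one face with $\nabla_i=\nabla\cap\Delta_i$ and $\nabla_n\ne\emptyset$. Blow-up. For an ordered simplicial complex $K$, $N_*(K)$ is its simplicial chain complex over $R$, $N^*(K)=\operatorname{Hom}(N_*(K),R)$ with $(\delta f)(v)=-(-1)^{|f|}f(\partial v)$, and $\mathbf 1_F$ is the cochain equal to $1$ on the simplex $F$ and $0$ on the others. For a simplex $E$, $\mathtt cE=E*[\mathtt v]$ is the cone with apex $\mathtt v$ as last vertex ($\mathtt c\emptyset=[\mathtt v]$); its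 faces are written $(F,0)=F$ ($\emptyset\ne F$ a face of $E$) and $(F,1)=F*[\mathtt v]$ ($F$ a possibly empty face of $E$). Put $|(F,\varepsilon)|=\dim F+\varepsilon$, with $|(\emptyset,1)|=0$. For a regular simplex $\Delta$ put $\widetilde N^*(\Delta)=N^*(\mathtt c\Delta_0)\otimes\dots\otimes N^*(\mathtt c\Delta_{n-1})\otimes N^*(\Delta_n)$ with the tensor product differential and basis $\mathbf 1_{(F,\varepsilon)}=\mathbf 1_{(F_0,\varepsilon_0)}\otimes\dots\otimes\mathbf 1_{(F_{n-1},\varepsilon_{n-1})}\otimes\mathbf 1_{F_n}$ ($\varepsilon_n=0$, $F_n\neq\emptyset$). For $\ell\in\{1,\dots,n\}$, $\|\mathbf 1_{(F,\varepsilon)}\|_\ell=-\infty$ if $\varepsilon_{n-\ell}=1$ and $=\sum_{i>n-\ell}|(F_i,\varepsilon_i)|$ if $\varepsilon_{n-\ell}=0$; for a linear combination with non-zero coefficients take the maximum; $\|0\|_\ell=-\infty$. $\widetilde N^*(X;R)$ is the complex of families $\omega=(\omega_\sigma)_\sigma$ indexed by regular simplices $\sigma\colon\Delta\to X$, $\omega_\sigma\in\widetilde N^*(\Delta)$, with $\delta_\ell^*\omega_\sigma=\omega_{\sigma\circ\delta_\ell}$ for every regular face operator; $(\delta\omega)_\sigma=\delta(\omega_\sigma)$. For a singular stratum $S$, $\|\omega\|_S=\sup\{\|\omega_\sigma\|_{\operatorname{codim}S}: \sigma\text{ regular},\ \operatorname{im}\sigma\cap S\neq\emptyset\}$. $\omega$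 is $\overline p$-allowable if $\|\omega\|_S\le\overline p(S)$ for all singular $S$. $\widetilde N^*_{\overline p}(X;R)$ is the complex of $\omega$ with $\omega,\delta\omega$ both $\overline p$-allowable. Small cochains. For an open cover $\mathcal U$ of $X$, a $\mathcal U$-small simplex is a regular simplex $\sigma\colon\Delta\to X$ with $\operatorname{im}\sigma\subset U$ for some $U\in\mathcal U$. $\widetilde N^{*,\mathcal U}(X;R)$ is defined like $\widetilde N^*(X;R)$ but with families $(\omega_\sigma)$ indexed only by $\mathcal U$-small simplices (compatible with regular face operators), and $\widetilde N^{*,\mathcal U}_{\overline p}(X;R)$ is the subcomplex of those $\omega$ such that $\omega$ and $\delta\omega$ are $\overline p$-allowable (with $\|\cdot\|_S$ computed over $\mathcal U$-small simplices). The restriction map $\rho_{\mathcal U}$ restricts a family to $\mathcal U$-small simplices. In (ii), the hypothesis concerns $\mathcal U$-small simplices $\sigma$ and the conclusion all regular simplices $\sigma$. *)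

(* Defs.v *)
From HB Require Import structures.
From mathcomp Require Import all_boot all_order all_algebra.
From mathcomp Require Import all_classical all_reals all_analysis.

Set Implicit Arguments.
Unset Strict Implicit.
Unset Printing Implicit Defensive.
Import Order.TTheory GRing.Theory Num.Theory.
Import numFieldNormedType.Exports.
Local Open Scope classical_set_scope.
Local Open Scope ring_scope.

(* [pred_skeleton F i] is F_(i-1), with the convention F_(-1) = set0. *)
Definition pred_skeleton (T : Type) (F : nat -> set T) (i : nat) : set T :=
  if i is j.+1 then F j else set0.

(* The filtration is X_0, ..., X_n with n = fdim.  It is indexed by nat, but
   [skeleton_top] and [skeleton_le] force X_i = setT for i >= n, so that no
   extra data is carried by the indices above n. *)
Record filtered_space := FilteredSpace {
  fcarrier :> topologicalType;
  fdim : nat;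
  skeleton : nat -> set fcarrier;
  fcarrier_hausdorff : hausdorff_space fcarrier;
  skeleton_closed : forall i, closed (skeleton i);
  skeleton_le : forall i j, (i <= j)%N -> skeleton i `<=` skeleton j;
  skeleton_top : skeleton fdim = setT;
  skeleton_proper : pred_skeleton skeleton fdim != setT }.
Arguments skeleton : clear implicits.

Section Perversities.
Variable X : filtered_space.

Definition pure_part (i : nat) : set X :=
  skeleton X i `\` pred_skeleton (skeleton X) i.

(* [stratum_index] is determined by [stratum_set], a stratum being non-empty
   and the pure parts being pairwise disjoint. *)
Record stratum := Stratum {
  stratum_index : nat;
  stratum_set :> set X;
  stratumP : exists2 x, pure_part stratum_index x &
    stratum_set = connected_component (pure_part stratum_index) x }.

Definition codim (S : stratum) : nat := (fdim X - stratum_index S)%N.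

Record perversity := Perversity {
  perv :> stratum -> \bar int;
  perv_regular : forall S, codim S = 0%N -> perv S = 0%E }.

End Perversities.

Definition is_open_cover (X : topologicalType) (U : set (set X)) : Prop :=
  (forall V, U V -> open V) /\ \bigcup_(V in U) V = setT.

Definition stdsimplex (RR : realType) (m : nat) : set 'rV[RR]_m.+1 :=
  [set t | (forall v, 0 <= t ord0 v) /\ \sum_v t ord0 v = 1].
Arguments stdsimplex : clear implicits.

Section Face.
Variables (RR : realType) (m : nat) (l : 'I_m.+2).

Definition face_row (t : 'rV[RR]_m.+1) : 'rV[RR]_m.+2 :=
  \row_v (if unlift l v is Some w then t ord0 w else 0).

Lemma face_rowP (t : stdsimplex RR m) :
  face_row (set_val t) \in stdsimplex RR m.+1.
Proof.
have [t0 t1] := set_mem (valP t).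
apply/mem_set; split => [v|].
  by rewrite mxE; case: unliftP => [w _|_].
rewrite (bigD1 l) //= mxE unlift_none add0r -t1.
rewrite (reindex (lift l)) /=.
  apply: eq_big => [w|w _]; first by rewrite eq_sym neq_lift.
  by rewrite mxE liftK.
exists (fun v => odflt ord0 (unlift l v)) => v.
  by rewrite liftK.
by rewrite inE eq_sym => /unlift_some [w -> ->].
Qed.

(* The inclusion of the face opposite to the vertex [l]. *)
Definition face_incl (t : stdsimplex RR m) : stdsimplex RR m.+1 :=
  exist _ (face_row (set_val t)) (face_rowP t).

Lemma face_row_continuous : continuous face_row.
Proof.
move=> t A [P tP PA]; exists (fun i w => P i (lift l w)) => [i w|t' Pt'].
  by have := tP i (lift l w); rewrite ord1 mxE liftK.
apply: PA => i v; rewrite ord1 mxE; case: unliftP => [w ->|->] /=.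
  exact: Pt'.
by apply: nbhs_singleton; have := tP ord0 l; rewrite mxE unlift_none.
Qed.

Lemma face_incl_continuous : continuous face_incl.
Proof.
apply: continuous_comp_initial => t /=.
apply: (@continuous_comp _ _ _ set_val face_row).
  exact: initial_continuous.
exact: face_row_continuous.
Qed.

End Face.

(* A join decomposition Delta = Delta_0 * ... * Delta_n of the standard
   m-simplex that is compatible with the vertex order is a nondecreasing map
   [lab] from the vertices to {0, ..., n}: the vertices of Delta_i are those
   labelled i, and Delta_0 * ... * Delta_i is the set of points of Delta whose
   barycentric coordinates vanish at the vertices labelled > i. *)
Section FilteredSimplices.
Variables (RR : realType) (X : filtered_space).

Record fsimplex (m : nat) := FilteredSimplex {
  lab : {ffun 'I_m.+1 -> 'I_(fdim X).+1};
  fsimplex_map :> stdsimplex RR m -> X;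
  lab_homo : {homo lab : v w / (v <= w)%N};
  fsimplex_continuous : continuous fsimplex_map;
  fsimplex_filtered : forall (i : 'I_(fdim X).+1) t,
    skeleton X i (fsimplex_map t) <->
    (forall v, (i < lab v)%N -> set_val t ord0 v = 0) }.

Definition is_regular (m : nat) (s : fsimplex m) : Prop :=
  exists v, lab s v = ord_max.

Definition face_lab (m : nat) (l : 'I_m.+2)
    (la : {ffun 'I_m.+2 -> 'I_(fdim X).+1}) :
    {ffun 'I_m.+1 -> 'I_(fdim X).+1} :=
  [ffun v => la (lift l v)].

Section FaceSimplex.
Variables (m : nat) (l : 'I_m.+2) (s : fsimplex m.+1).

Lemma face_lab_homo : {homo face_lab l (lab s) : v w / (v <= w)%N}.
Proof.
move=> v w vw; rewrite !ffunE; apply: lab_homo.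
by rewrite /= leq_bump2.
Qed.

Lemma face_continuous : continuous (s \o @face_incl RR m l).
Proof.
move=> t; apply: continuous_comp; first exact: face_incl_continuous.
exact: fsimplex_continuous.
Qed.

Lemma face_filtered (i : 'I_(fdim X).+1) t :
  skeleton X i ((s \o @face_incl RR m l) t) <->
  (forall v, (i < face_lab l (lab s) v)%N -> set_val t ord0 v = 0).
Proof.
rewrite /= fsimplex_filtered; split=> [h v|h v].
  by rewrite ffunE => /h; rewrite set_valE /= mxE liftK.
rewrite set_valE /= mxE; case: unliftP => [w ->|//] iw.
by apply: h; rewrite ffunE.
Qed.

(* sigma \o delta_l; the face operator delta_l is regular (for sigma) when
   this simplex is again regular. *)
Definition face : fsimplex m :=
  FilteredSimplex face_lab_homo face_continuous face_filtered.

End FaceSimplex.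
End FilteredSimplices.

(* A face (F, eps) of the cone c(Delta_i) is encoded by the set F of its
   vertices in Delta_i and the boolean eps telling whether the apex, which
   comes last in the vertex order, belongs to it. *)
Section ConeFaces.
Variable m : nat.

Definition coneface : Type := ({set 'I_m.+1} * bool)%type.

Implicit Types f g : coneface.

Definition coneface_dim f : nat := (#|f.1| + f.2).-1.

(* The coefficient of [g] in the simplicial boundary of [f]; here the 0-th
   term of each alternating sum is the removal of the first vertex. *)
Definition bd_coef f g : int :=
  \sum_(v in f.1 | g == (f.1 :\ v, f.2))
     (-1) ^+ #|[pred w in f.1 | (w < v)%N]|
  + (if f.2 && (g == (f.1, false)) then (-1) ^+ #|f.1| else 0).

(* The coefficient of 1_f in the coboundary of 1_g, where
   (delta h)(v) = - (-1) ^ |h| h (bd v). *)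
Definition cobd_coef g f : int := - (-1) ^+ coneface_dim g * bd_coef f g.

End ConeFaces.

Section BlowUp.
Variables (R : comPzRingType) (m n : nat) (la : {ffun 'I_m.+1 -> 'I_n.+1}).

(* The index set of the basis 1_(F,eps): families of faces of the cones
   c(Delta_0), ..., c(Delta_(n-1)) and of Delta_n. *)
Definition is_cell (c : {ffun 'I_n.+1 -> coneface m}) : bool :=
  [forall i, ((c i).1 \subset [pred v | la v == i]) &&
             (((c i).1 != finset.set0) || (c i).2)]
  && ~~ (c ord_max).2.

Definition cell : Type := {c : {ffun 'I_n.+1 -> coneface m} | is_cell c}.

HB.instance Definition _ := Finite.on cell.

(* The blow-up of Delta: as an R-module, the tensor product is free on the
   1_(F,eps), and a cochain is given by its coordinates in that basis. *)
Definition blowup : Type := {ffun cell -> R^o}.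

HB.instance Definition _ := GRing.Lmodule.on blowup.

Implicit Types (c d : cell) (w : blowup).

Definition cell_dim c : nat := (\sum_i coneface_dim (val c i))%N.

(* The coefficient of 1_d in the tensor product differential of 1_c:
   delta (a_0 (x) ... (x) a_n) =
   \sum_i (-1) ^ (|a_0| + ... + |a_(i-1)|) a_0 (x) ... (x) delta a_i (x) ... *)
Definition tensor_cobd_coef c d : int :=
  \sum_(i | [forall j, (j != i) ==> (val c j == val d j)])
     (-1) ^+ (\sum_(j < n.+1 | (j < i)%N) coneface_dim (val c j))%N
     * cobd_coef (val c i) (val d i).

Definition blowup_diff w : blowup :=
  [ffun d => \sum_c (tensor_cobd_coef c d)%:~R * w c].

(* || 1_c ||_l for 1 <= l <= n. *)
Definition cell_norm (l : nat) c : \bar int :=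
  if (val c (inord (n - l))).2 then -oo%E
  else ((\sum_(i < n.+1 | (n - l < i)%N) coneface_dim (val c i))%N%:Z)%:E.

Definition blowup_norm (l : nat) w : \bar int :=
  \big[maxe/-oo%E]_(c | w c != 0) cell_norm l c.

End BlowUp.

Section BlowUpFace.
Variables (R : comPzRingType) (m : nat) (X : filtered_space) (l : 'I_m.+2).
Variable la : {ffun 'I_m.+2 -> 'I_(fdim X).+1}.

Lemma face_cellP (c : cell (face_lab l la)) :
  is_cell la [ffun i => (lift l @: (val c i).1, (val c i).2)].
Proof.
case: c => c /= /andP [/forallP cP cn].
rewrite /is_cell !ffunE /= cn andbT; apply/forallP => i; rewrite ffunE /=.
have /andP [ci ci0] := cP i; rewrite imset_eq0 ci0 andbT.
apply/fintype.subsetP => _ /imsetP [v vc ->]; rewrite inE.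
by have := fintype.subsetP ci v vc; rewrite inE ffunE.
Qed.

(* delta_l^*, restriction of cochains along the face inclusion: the value of
   the image on a face is the value on that face seen in Delta. *)
Definition blowup_face (w : blowup R la) : blowup R (face_lab l la) :=
  [ffun c => w (Sub _ (face_cellP c))].

End BlowUpFace.

Section Families.
Variables (RR : realType) (R : comPzRingType) (X : filtered_space).

Definition simplex_class : Type := forall m, set (fsimplex RR X m).

Definition regular_simplices : simplex_class :=
  fun m => [set s | is_regular s].

Definition small_simplices (U : set (set X)) : simplex_class :=
  fun m => [set s | is_regular s /\ exists2 V, U V & range s `<=` V].

(* Families (omega_sigma) indexed by the simplices of the class [A]. *)
Definition cochain_family (A : simplex_class) : Type :=
  forall m (s : fsimplex RR X m), A m s -> blowup R (lab s).

Section FamilyModule.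
Variable A : simplex_class.
Implicit Types (x y z : cochain_family A) (a b : R).

HB.instance Definition _ := gen_eqMixin (cochain_family A).
HB.instance Definition _ := gen_choiceMixin (cochain_family A).

Let fam0 : cochain_family A := fun m s As => 0.
Let famN x : cochain_family A := fun m s As => - x m s As.
Let famD x y : cochain_family A := fun m s As => x m s As + y m s As.
Let famZ a x : cochain_family A := fun m s As => a *: x m s As.

Lemma familyP x y : (forall m s As, x m s As = y m s As) -> x = y.
Proof.
by move=> xy; do 3![apply: functional_extensionality_dep => ?]; apply: xy.
Qed.

Let famDA : associative famD.
Proof. by move=> x y z; apply: familyP => m s As; apply: addrA. Qed.
Let famDC : commutative famD.
Proof. by move=> x y; apply: familyP => m s As; apply: addrC. Qed.
Let fam0D : left_id fam0 famD.
Proof. by move=> x; apply: familyP => m s As; apply: add0r. Qed.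
Let famND : left_inverse fam0 famN famD.
Proof. by move=> x; apply: familyP => m s As; apply: addNr. Qed.

HB.instance Definition _ :=
  GRing.isZmodule.Build (cochain_family A) famDA famDC fam0D famND.

Let famZA a b x : famZ a (famZ b x) = famZ (a * b) x.
Proof. by apply: familyP => m s As; apply: scalerA. Qed.
Let fam1Z : left_id 1 famZ.
Proof. by move=> x; apply: familyP => m s As; apply: scale1r. Qed.
Let famZDr : right_distributive famZ +%R.
Proof. by move=> a x y; apply: familyP => m s As; apply: scalerDr. Qed.
Let famZDl x : {morph famZ^~ x : a b / a + b}.
Proof. by move=> a b; apply: familyP => m s As; apply: scalerDl. Qed.

HB.instance Definition _ :=
  GRing.Zmodule_isLmodule.Build R (cochain_family A) famZA fam1Z famZDr famZDl.

End FamilyModule.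

Variable p : perversity X.

Section Complex.
Variable A : simplex_class.
Implicit Types w : cochain_family A.

Definition compatible w : Prop :=
  forall m (s : fsimplex RR X m.+1) (l : 'I_m.+2)
         (As : A s) (Al : A (face l s)),
    blowup_face l (w m.+1 s As) = w m (face l s) Al.

Definition of_degree (k : int) w : Prop :=
  forall m s (As : A s) c, w m s As c != 0 -> (cell_dim c)%:Z = k.

Definition coboundary w : cochain_family A :=
  fun m s As => blowup_diff (w m s As).

(* || omega ||_S; the supremum is taken in the complete chain \bar int, where
   the supremum of the empty set is -oo. *)
Definition perverse_degree (S : stratum X) w : \bar int :=
  supremum -oo%E [set e | exists m (s : fsimplex RR X m) (As : A s),
    range s `&` S !=set0 /\ e = blowup_norm (codim S) (w m s As)].

Definition allowable w : Prop :=
  forall S : stratum X, (0 < codim S)%N -> (perverse_degree S w <= p S)%E.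

(* The component of degree k of the complex of the p-intersection cochains on
   the simplices of the class [A]: N~_p(X; R) for [regular_simplices] and
   N~_p^U(X; R) for [small_simplices U].  Degrees are integers, the components
   of negative degree being zero. *)
Definition icochain (k : int) : set (cochain_family A) :=
  [set w | [/\ compatible w, of_degree k w,
                allowable w & allowable (coboundary w)]].

End Complex.

(* A homogeneous R-linear map of degree d from the p-intersection cochains on
   A to those on B.  It is given by a function on all families, of which only
   the restriction to the complexes is relevant. *)
Definition graded_linear (A B : simplex_class) (d : int)
    (f : cochain_family A -> cochain_family B) : Prop :=
  forall k,
    (forall w, icochain k w -> icochain (k + d) (f w)) /\
    (forall a w w', icochain k w -> icochain k w' ->
       f (a *: w + w') = a *: f w + f w').

Definition cochain_map (A B : simplex_class)
    (f : cochain_family A -> cochain_family B) : Prop :=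
  graded_linear 0 f /\
  (forall k w, icochain k w -> f (coboundary w) = coboundary (f w)).

Definition restriction (U : set (set X))
    (w : cochain_family regular_simplices) :
    cochain_family (small_simplices U) :=
  fun m s Us => w m s (proj1 Us).

Definition vanishes_off (K : set X) (A : simplex_class)
    (w : cochain_family A) : Prop :=
  forall m s (As : A m s), range s `&` K = set0 -> w m s As = 0.

End Families.

Arguments regular_simplices : clear implicits.
Arguments small_simplices RR [X] U.

(* Main.v *)
Require Import Defs.
From mathcomp Require Import all_boot all_order all_algebra.
From mathcomp Require Import all_classical all_reals all_analysis.
From mathcomp Require Import ring lra zify.

(** Why the theorem holds.

    A compatible family is determined by its values on the full cells, that is
    on the pairs (e, sigma) of a regular simplex sigma and a set e of indices
    (the factors whose apex belongs to the cell), subject to legality: the last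
    index is not in e, and each index occurs in e or as a label of sigma.
    After multiplication by a suitable sign [norm_sign] the coboundary becomes
      (dG)(e, sigma) = sum_k (-1)^k G(e, d_k sigma)
                       + (-1)^(dim sigma + 1) sum_(i in e) +-G(e - i, sigma),
    where illegal pairs count for 0 and the last sign depends on e and i only
    ([blowup_diff_blowup_of]).  The second sum does not touch sigma.  Hence an
    operator on ordinary ordered simplices that is natural and creates no new
    label acts on blow-up cochains, with e as a mere parameter, and any
    homotopy relation for the ordinary boundary carries over
    ([sd_full_cobd], [htp_full_homotopy]).  Such an operator preserves
    allowability if, for every j, it never decreases the number of vertices of
    label > j: this number controls the norms of 1_(F, eps), and a stratum
    met by sigma is still met by the pieces that matter ([allowable_derived]).

    The operator is an adaptive barycentric subdivision sd: a small simplex is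
    left alone, any other one is replaced by the cone, from its barycentre,
    over the subdivision of its boundary.  The barycentre has the highest of
    the labels of the vertices, so it comes last in the vertex order, and in
    passing from a simplex to a facet and back to a cone no vertex of label > j
    is lost.  The same cone construction gives T with
    bd T + T bd = id - sd ([htp_homotopy]); on small simplices sd is the
    identity and T is 0.  Once all pieces of sd^N sigma are small, sd^N sigma no
    longer depends on N, nor does sum_(i < N) T sd^i sigma.  The limits r and D
    therefore satisfy bd D + D bd = id - r, and r is a chain map onto small
    simplices that is the identity on them.  Then phi and Theta are the
    transposes of r and D.  Adaptivity is what makes this respect perversities:
    iterating the ordinary subdivision a number of times that depends on sigma
    forces correction terms supported on facets of sigma, and a facet may have
    fewer vertices of label > j.

    That subdivision terminates ([stable_ex]) is a compactness argument.  Take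
    an infinite sequence of non-small pieces, each a piece of the preceding
    one, and let P be the set of vertices that are retained forever.  If P is
    empty, all vertices are eventually replaced by barycentres and the diameter
    shrinks by a factor 1 - 1/K, K being the number of vertices.  Otherwise,
    eventually every new vertex is the barycentre of a face containing P, and it is the
    distance to the convex hull of P that shrinks; that hull is small, being
    spanned by part of a retained small face.  In both cases the pieces end up
    inside one member of the cover. *)

Set Implicit Arguments.
Unset Strict Implicit.
Unset Printing Implicit Defensive.
Import Order.TTheory GRing.Theory Num.Theory.
Import numFieldNormedType.Exports.
Local Open Scope ring_scope.

(** * Subdivision of ordered simplices, acting on cochains *)

Section ListChains.
Variables (R : comPzRingType) (T : Type).
Implicit Types (F G : seq T -> R) (l u : seq T) (x : T).

(** An ordered simplex is the list of its vertices; the empty list is the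
    augmentation, for which the cone formula [bd_rcons] holds without exception. *)
Inductive facet : seq T -> seq T -> Prop :=
| facet_head x l : facet l (x :: l)
| facet_tail x l1 l : facet l1 l -> facet (x :: l1) (x :: l).

(** The transpose of the simplicial boundary: the alternating sum of the values
    of F over the facets.  All operators below are transposes of operators on
    chains, so that no module of formal chains is needed. *)
Fixpoint bd F l : R :=
  if l is x :: l' then F l' - bd (fun u => F (x :: u)) l' else 0.

(** Transpose of the cone operator that appends x as last vertex. *)
Definition cone_dual x F : seq T -> R := fun u => F (rcons u x).

Lemma facet_size l1 l : facet l1 l -> size l = (size l1).+1.
Proof. by elim=> // x m1 m _ /= ->. Qed.

Lemma eq_bd F G l :
  (forall l1, facet l1 l -> F l1 = G l1) -> bd F l = bd G l.
Proof.
elim: l F G => //= x l IH F G FG; rewrite FG; last exact: facet_head.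
by congr (_ - _); apply: IH => l1 l1l; apply: FG; apply: facet_tail.
Qed.

Lemma bd_lin a F G l : bd (fun u => a * F u + G u) l = a * bd F l + bd G l.
Proof.
elim: l F G => [|x l IH] F G /=; first by rewrite mulr0 addr0.
by rewrite IH; ring.
Qed.

Lemma bdB F G l : bd (fun u => F u - G u) l = bd F l - bd G l.
Proof.
by elim: l F G => [|x l IH] F G /=; rewrite ?subr0 // IH; ring.
Qed.

Lemma bd_eq0 F l : (forall l1, facet l1 l -> F l1 = 0) -> bd F l = 0.
Proof.
move=> F0; rewrite (@eq_bd _ (fun=> 0)) //.
by elim: l {F0} => //= x l ->; rewrite subr0.
Qed.

(** The recursion on the first vertex gives bd (bd F) (x :: l) =
    bd F l - (bd F l - bd (bd (F (x :: -))) l), so no pairing of terms is needed. *)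
Lemma bd_bd F l : bd (bd F) l = 0.
Proof.
elim: l F => //= x l IH F.
by rewrite bdB IH subr0 subrr.
Qed.

Lemma bd_rcons F l x :
  bd F (rcons l x) = bd (cone_dual x F) l + (-1) ^+ size l * F l.
Proof.
rewrite /cone_dual; elim: l F => [|y l IH] F /=; first by rewrite expr0; ring.
by rewrite IH exprS; ring.
Qed.

(** [stop] tells which simplices are left alone and [b l] is the cone point used
    for the others. *)
Section Subdivision.
Variables (stop : pred (seq T)) (b : seq T -> T).
Hypothesis stop_nil : stop [::].
Hypothesis stop_facet : forall l1 l, facet l1 l -> stop l -> stop l1.

(** The cone is applied before the recursive call on the facets, because
    transposition reverses the order of composition; the fuel k is the number
    of vertices.  On chains: sd l = -(-1)^|l| cone (sd (bd l)) and
    T l = (-1)^|l| (cone l - cone (T (bd l))). *)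
Fixpoint sd_rec k F l : R :=
  if k is k'.+1 then
    if stop l then F l else
    - (-1) ^+ size l * bd (sd_rec k' (cone_dual (b l) F)) l
  else F l.

Fixpoint htp_rec k F l : R :=
  if k is k'.+1 then
    if stop l then 0 else
    (-1) ^+ size l * (F (rcons l (b l)) - bd (htp_rec k' (cone_dual (b l) F)) l)
  else 0.

Definition sd F l := sd_rec (size l) F l.
Definition htp F l := htp_rec (size l) F l.

Lemma sd_stop F l : stop l -> sd F l = F l.
Proof. by rewrite /sd; case: l => //= x l ->. Qed.

Lemma htp_stop F l : stop l -> htp F l = 0.
Proof. by rewrite /htp; case: l => //= x l ->. Qed.

Lemma sd_cone F l : ~~ stop l ->
  sd F l = - (-1) ^+ size l * bd (sd (cone_dual (b l) F)) l.
Proof.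
move=> sl; have [k ek] : exists k, size l = k.+1.
  by case: l sl => [|x l _]; [rewrite stop_nil | exists (size l)].
rewrite {1}/sd ek [LHS]/sd_rec -/sd_rec (negbTE sl) ek; congr (_ * _).
by apply: eq_bd => l1 /facet_size; rewrite ek /sd => -[->].
Qed.

Lemma htp_cone F l : ~~ stop l ->
  htp F l =
  (-1) ^+ size l * (F (rcons l (b l)) - bd (htp (cone_dual (b l) F)) l).
Proof.
move=> sl; have [k ek] : exists k, size l = k.+1.
  by case: l sl => [|x l _]; [rewrite stop_nil | exists (size l)].
rewrite {1}/htp ek [LHS]/htp_rec -/htp_rec (negbTE sl) ek; congr (_ * (_ - _)).
by apply: eq_bd => l1 /facet_size; rewrite ek /htp => -[->].
Qed.

(** The simplices on which [sd F l] depends.  Possible cancellations between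
    pieces are disregarded, which makes this relation easy to induct on. *)
Inductive sd_piece : seq T -> seq T -> Prop :=
| sd_piece_stop l : stop l -> sd_piece l l
| sd_piece_cone l l1 l2 : ~~ stop l -> facet l1 l -> sd_piece l1 l2 ->
    sd_piece l (rcons l2 (b l)).

Inductive htp_piece : seq T -> seq T -> Prop :=
| htp_piece_top l : ~~ stop l -> htp_piece l (rcons l (b l))
| htp_piece_cone l l1 l2 : ~~ stop l -> facet l1 l -> htp_piece l1 l2 ->
    htp_piece l (rcons l2 (b l)).

Lemma facet_wf_ind (P : seq T -> Prop) :
  (forall l, (forall l1, facet l1 l -> P l1) -> P l) -> forall l, P l.
Proof.
move=> IH l; move: {2}(size l) (leqnn (size l)) => k.
elim: k l => [|k IHk] l lk; apply: IH => l1 /facet_size ll1.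
  by rewrite ll1 in lk.
by apply: IHk; rewrite -ltnS -ll1.
Qed.

Lemma sd_ext F G l : (forall l', sd_piece l l' -> F l' = G l') ->
  sd F l = sd G l.
Proof.
elim/facet_wf_ind: l F G => l IH F G FG; have [sl|sl] := boolP (stop l).
  by rewrite !sd_stop //; apply: FG; constructor.
rewrite !sd_cone //; congr (_ * _); apply: eq_bd => l1 l1l.
by apply: IH => // l' l'1; apply: FG; apply: sd_piece_cone l'1.
Qed.

Lemma htp_ext F G l : (forall l', htp_piece l l' -> F l' = G l') ->
  htp F l = htp G l.
Proof.
elim/facet_wf_ind: l F G => l IH F G FG; have [sl|sl] := boolP (stop l).
  by rewrite !htp_stop.
rewrite !htp_cone //; congr (_ * (_ - _)); first by apply: FG; constructor.
apply: eq_bd => l1 l1l.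
by apply: IH => // l' l'1; apply: FG; apply: htp_piece_cone l'1.
Qed.

Lemma sd_lin a F G l : sd (fun u => a * F u + G u) l = a * sd F l + sd G l.
Proof.
elim/facet_wf_ind: l F G => l IH F G; have [sl|sl] := boolP (stop l).
  by rewrite !sd_stop.
rewrite !sd_cone // /cone_dual mulrCA -mulrDr -bd_lin; congr (_ * _).
by apply: eq_bd => l1 l1l; rewrite IH.
Qed.

Lemma htp_lin a F G l :
  htp (fun u => a * F u + G u) l = a * htp F l + htp G l.
Proof.
elim/facet_wf_ind: l F G => l IH F G; have [sl|sl] := boolP (stop l).
  by rewrite !htp_stop // mulr0 addr0.
rewrite !htp_cone // /cone_dual.
have -> : bd (htp (fun u => a * F (rcons u (b l)) + G (rcons u (b l)))) l =
    a * bd (htp (fun u => F (rcons u (b l)))) l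
    + bd (htp (fun u => G (rcons u (b l)))) l.
  by rewrite -bd_lin; apply: eq_bd => l1 l1l; rewrite IH.
ring.
Qed.

Lemma sd_piece_size l l' : sd_piece l l' -> size l' = size l.
Proof.
by elim=> // m l1 l2 _ /facet_size -> _; rewrite size_rcons => ->.
Qed.

Lemma htp_piece_size l l' : htp_piece l l' -> size l' = (size l).+1.
Proof.
elim=> [m _|m l1 l2 _ /facet_size -> _]; rewrite size_rcons // => ->.
by [].
Qed.

Lemma sd_eq0 F l : (forall l', sd_piece l l' -> F l' = 0) -> sd F l = 0.
Proof.
move=> F0; rewrite (@sd_ext _ (fun u => -1 * F u + F u)).
  by rewrite sd_lin mulN1r addNr.
by move=> l' /F0 ->; rewrite mulr0 addr0.
Qed.

Lemma htp_eq0 F l : (forall l', htp_piece l l' -> F l' = 0) -> htp F l = 0.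
Proof.
move=> F0; rewrite (@htp_ext _ (fun u => -1 * F u + F u)).
  by rewrite htp_lin mulN1r addNr.
by move=> l' /F0 ->; rewrite mulr0 addr0.
Qed.

(** Chain homotopy id - sd, by induction on the number of vertices.  The
    commutation of the cone with the boundary produces F itself up to the sign
    (-1)^|l|; that sign is constant on the pieces of T because they all have one
    vertex more than the simplex they come from. *)
Lemma htp_homotopy F l : htp (bd F) l + bd (htp F) l = F l - sd F l.
Proof.
elim/facet_wf_ind: l F => l IH F; have [sl|sl] := boolP (stop l).
  rewrite htp_stop // sd_stop // subrr add0r; apply: bd_eq0 => l1 l1l.
  by rewrite htp_stop //; apply: stop_facet l1l sl.
(* Expand both sides once; e is the sign of the cone and K the coned cochain. *)
rewrite htp_cone // sd_cone // bd_rcons.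
set e := (-1) ^+ size l; set K := cone_dual (b l) F.
have e2 : e * e = 1 by rewrite -expr2 sqrr_sign.
have -> : bd (htp (cone_dual (b l) (bd F))) l =
    bd K l - bd (sd K) l + e * bd (htp F) l.
  transitivity
    (bd (fun u => e * htp F u + ((K u - sd K u) - bd (htp K) u)) l).
    apply: eq_bd => l1 l1l; rewrite -[K l1 - sd K l1]IH // addrK -htp_lin.
    apply: htp_ext => l' l1l'; rewrite /cone_dual bd_rcons addrC.
    by rewrite (htp_piece_size l1l') -(facet_size l1l).
  by rewrite bd_lin !bdB bd_bd subr0 addrC.
have -> : e * (bd K l + e * F l - (bd K l - bd (sd K) l + e * bd (htp F) l))
   = (e * e) * F l + e * bd (sd K) l - (e * e) * bd (htp F) l by ring.
by rewrite e2; ring.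
Qed.

(** Formal consequence of the homotopy: bd commutes with id - T bd - bd T. *)
Lemma sd_bd F l : sd (bd F) l = bd (sd F) l.
Proof.
have := htp_homotopy (bd F) l.
have -> : bd (htp (bd F)) l = bd F l - bd (sd F) l.
  rewrite -bdB -[RHS]subr0 -[X in _ - X](bd_bd (htp F) l) -bdB.
  by apply: eq_bd => l1 _; rewrite -htp_homotopy addrK.
rewrite htp_eq0 => [|l' _]; last exact: bd_bd.
by rewrite add0r => /addrI /oppr_inj.
Qed.

Definition sd_iter N F := iter N sd F.

Fixpoint htp_iter N F l : R :=
  if N is N'.+1 then htp F l + sd (htp_iter N' F) l else 0.

Fixpoint stable N l : Prop :=
  if N is N'.+1 then forall l', sd_piece l l' -> stable N' l' else stop l.

Lemma sd_iter_bd N F l : sd_iter N (bd F) l = bd (sd_iter N F) l.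
Proof.
elim: N l => [|N IH] l //=; rewrite -sd_bd.
by apply: sd_ext => l' _; apply: IH.
Qed.

Lemma htp_iter_homotopy N F l :
  htp_iter N (bd F) l + bd (htp_iter N F) l = F l - sd_iter N F l.
Proof.
elim: N l => [|N IH] l /=; first by rewrite bd_eq0 // addr0 subrr.
have -> : bd (fun l => htp F l + sd (htp_iter N F) l) l =
    bd (htp F) l + sd (bd (htp_iter N F)) l.
  by rewrite sd_bd -[bd (htp F) l]mul1r -bd_lin; apply: eq_bd => *; rewrite mul1r.
rewrite addrACA htp_homotopy -[sd (htp_iter N _) l]mul1r -sd_lin.
have -> : sd (fun u => 1 * htp_iter N (bd F) u + bd (htp_iter N F) u) l =
    sd (fun u => -1 * sd_iter N F u + F u) l.
  by apply: sd_ext => l' _; rewrite mul1r IH mulN1r addrC.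
by rewrite sd_lin mulN1r addrCA addrC subrK addrC.
Qed.

Lemma sd_iter_lin N a F G l :
  sd_iter N (fun u => a * F u + G u) l = a * sd_iter N F l + sd_iter N G l.
Proof.
elim: N l => [|N IH] l //=; rewrite -sd_lin.
by apply: sd_ext => l' _; apply: IH.
Qed.

Lemma htp_iter_lin N a F G l :
  htp_iter N (fun u => a * F u + G u) l = a * htp_iter N F l + htp_iter N G l.
Proof.
elim: N l => [|N IH] l /=; first by rewrite mulr0 addr0.
rewrite htp_lin (@sd_ext _ (fun u => a * htp_iter N F u + htp_iter N G u)) //.
by rewrite sd_lin; ring.
Qed.

Lemma sd_piece_at_stop l l' : stop l -> sd_piece l l' -> l' = l.
Proof. by move=> sl p; case: p sl => // m l1 l2 /negP. Qed.

Lemma stable_stop N l : stop l -> stable N l.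
Proof.
by elim: N l => //= N IH l sl l' /(sd_piece_at_stop sl) ->; apply: IH.
Qed.

Lemma stableS N l : stable N l -> stable N.+1 l.
Proof.
elim: N l => [|N IH] l; first exact: stable_stop.
by move=> /= sl l' /sl /IH.
Qed.

(** The pieces of a facet of l become facets of pieces of l once the cone point
    of l is appended; this is why the depth of l works for its facets too. *)
Lemma stable_facet N l1 l : facet l1 l -> stable N l -> stable N l1.
Proof.
elim: N l1 l => [|N IH] l1 l l1l; first exact: stop_facet.
have [sl _|sl st] := boolP (stop l).
  by apply: stable_stop; apply: stop_facet l1l sl.
move=> l' l1l'; apply: IH (st _ (sd_piece_cone sl l1l l1l')).
by elim: {l1l'} l' => [|x u IHu] /=; constructor.
Qed.

(** Finite branching: l has finitely many facets, hence finitely many pieces. *)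
Lemma facet_bound (W : nat -> seq T -> Prop) l :
  (forall N l1, W N l1 -> W N.+1 l1) ->
  (forall l1, facet l1 l -> exists N, W N l1) ->
  exists N, forall l1, facet l1 l -> W N l1.
Proof.
move=> WS; have Wle N N' l1 : (N <= N')%N -> W N l1 -> W N' l1.
  by move=> /subnK <- ?; elim: (N' - N)%N => //= k; apply: WS.
elim: l W WS Wle => [|x l IH] W WS Wle Wl; first by exists 0%N => l1 f; inversion f.
have [N1 WN1] := Wl _ (facet_head x l).
have [|||N2 WN2] := IH (fun N l1 => W N (x :: l1)).
- by move=> N l1; apply: WS.
- by move=> N N' l1; apply: Wle.
- by move=> l1 l1l; apply: Wl; apply: facet_tail.
exists (maxn N1 N2) => l1 f; inversion f as [y u|y u1 u fu]; subst.
  by apply: Wle WN1; apply: leq_maxl.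
by apply: Wle (WN2 _ fu); apply: leq_maxr.
Qed.

Lemma sd_piece_bound (W : nat -> seq T -> Prop) l :
  (forall N l1, W N l1 -> W N.+1 l1) ->
  (forall l', sd_piece l l' -> exists N, W N l') ->
  exists N, forall l', sd_piece l l' -> W N l'.
Proof.
elim/facet_wf_ind: l W => l IH W WS Wl; have [sl|sl] := boolP (stop l).
  have [N WN] := Wl _ (sd_piece_stop sl).
  by exists N => l' /(sd_piece_at_stop sl) ->.
pose W1 N l1 := forall l2, sd_piece l1 l2 -> W N (rcons l2 (b l)).
have [N l1 W1N l2 /W1N /WS //|l1 l1l|N WN] := @facet_bound W1 l.
  apply: (IH _ l1l (fun N l2 => W N (rcons l2 (b l)))) => [N l2|l2 l12].
    exact: WS.
  by apply: Wl; apply: sd_piece_cone l12.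
exists N => l' p; inversion p as [u su|u l1 l2 _ f q]; subst; last exact: WN q.
by rewrite su in sl.
Qed.

Lemma stable_branch l :
  (forall l', sd_piece l l' -> exists N, stable N l') -> exists N, stable N l.
Proof.
move=> /(sd_piece_bound (fun N l1 => @stableS N l1)) [N st].
by exists N.+1.
Qed.

Lemma sd_iterS_stable N F l : stable N l -> sd_iter N.+1 F l = sd_iter N F l.
Proof.
elim: N l => [|N IH] l st; first exact: sd_stop.
by apply: sd_ext => l' /st /IH.
Qed.

(** T vanishes on stopped simplices, so the extra term of the sum is zero. *)
Lemma htp_iterS_stable N F l : stable N l -> htp_iter N.+1 F l = htp_iter N F l.
Proof.
elim: N l => [|N IH] l st; first by rewrite /= htp_stop // add0r sd_eq0.
by congr (_ + _); apply: sd_ext => l' /st /IH.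
Qed.

Lemma sd_iter_indep N N' F l :
  stable N l -> stable N' l -> sd_iter N F l = sd_iter N' F l.
Proof.
have H k M : stable M l ->
    sd_iter (k + M) F l = sd_iter M F l /\ stable (k + M) l.
  move=> st; elim: k => [|k [IH1 IH2]]; first by [].
  rewrite addSn sd_iterS_stable; last by [].
  by split; [|apply: stableS].
move=> st st'; have [le|/ltnW le] := leqP N N'.
  by have [<- _] := H (N' - N)%N _ st; rewrite subnK.
by have [<- _] := H (N - N')%N _ st'; rewrite subnK.
Qed.

Lemma htp_iter_indep N N' F l :
  stable N l -> stable N' l -> htp_iter N F l = htp_iter N' F l.
Proof.
have H k M : stable M l ->
    htp_iter (k + M) F l = htp_iter M F l /\ stable (k + M) l.
  move=> st; elim: k => [|k [IH1 IH2]]; first by [].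
  rewrite addSn htp_iterS_stable; last by [].
  by split; [|apply: stableS].
move=> st st'; have [le|/ltnW le] := leqP N N'.
  by have [<- _] := H (N' - N)%N _ st; rewrite subnK.
by have [<- _] := H (N - N')%N _ st'; rewrite subnK.
Qed.

(** Locality: Q is any property of simplices inherited by pieces. *)
Lemma sd_iter_eq0 (Q : seq T -> Prop) N F l :
  (forall l1 l2, Q l1 -> sd_piece l1 l2 -> Q l2) ->
  (forall l', Q l' -> stop l' -> F l' = 0) ->
  Q l -> stable N l -> sd_iter N F l = 0.
Proof.
move=> Qsd F0; elim: N l => [|N IH] l Ql st; first exact: F0.
by apply: sd_eq0 => l' ll'; apply: IH; [apply: Qsd ll'|apply: st].
Qed.

Lemma htp_iter_eq0 (Q : seq T -> Prop) N F l :
  (forall l1 l2, Q l1 -> sd_piece l1 l2 -> Q l2) ->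
  (forall l1 l2, Q l1 -> htp_piece l1 l2 -> F l2 = 0) ->
  Q l -> htp_iter N F l = 0.
Proof.
move=> Qsd F0; elim: N l => [|N IH] l Ql //=.
rewrite htp_eq0 ?add0r => [|l' ll']; last exact: F0 ll'.
by apply: sd_eq0 => l' ll'; apply: IH; apply: Qsd ll'.
Qed.

Hypothesis stable_ex : forall l, exists N, stable N l.

(** From here on every simplex is subdivided into stopped pieces after finitely
    many steps.  The limit operators below use a number of steps that depends
    on l, but by [sd_iter_indep] any larger number gives the same value; in
    particular the depth of l may be used for its facets, and no correction
    term appears in the next two identities. *)
Definition depth l : nat := projT1 (cid (stable_ex l)).

Lemma depthP l : stable (depth l) l.
Proof. by rewrite /depth; case: cid. Qed.

Definition fine_sd F l := sd_iter (depth l) F l.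
Definition fine_htp F l := htp_iter (depth l) F l.

Lemma fine_sdE N F l : stable N l -> fine_sd F l = sd_iter N F l.
Proof. by move=> st; apply: sd_iter_indep => //; apply: depthP. Qed.

Lemma fine_htpE N F l : stable N l -> fine_htp F l = htp_iter N F l.
Proof. by move=> st; apply: htp_iter_indep => //; apply: depthP. Qed.

Lemma fine_sd_bd F l : fine_sd (bd F) l = bd (fine_sd F) l.
Proof.
rewrite /fine_sd sd_iter_bd; apply: eq_bd => l1 l1l.
by rewrite -fine_sdE //; apply: stable_facet l1l (depthP l).
Qed.

Lemma fine_homotopy F l :
  fine_htp (bd F) l + bd (fine_htp F) l = F l - fine_sd F l.
Proof.
rewrite -htp_iter_homotopy; congr (_ + _); apply: eq_bd => l1 l1l.
by apply: fine_htpE; apply: stable_facet l1l (depthP l).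
Qed.

Lemma fine_sd_stop F l : stop l -> fine_sd F l = F l.
Proof. by move=> sl; rewrite (@fine_sdE 0). Qed.

End Subdivision.

End ListChains.

Section Naturality.
Variables (R : comPzRingType) (T T' : Type) (A : T -> T').
Implicit Types (F : seq T' -> R) (l : seq T).

Lemma facet_map (l1' : seq T') l : facet l1' (map A l) ->
  exists2 l1, facet l1 l & l1' = map A l1.
Proof.
elim: l l1' => [|x l IH] l1' f /=; first by inversion f.
inversion f as [y m|y m1 m fm]; subst; first by exists l => //; constructor.
by have [l1 l1l ->] := IH _ fm; exists (x :: l1) => //; constructor.
Qed.

Lemma bd_map F l : bd F (map A l) = bd (F \o map A) l.
Proof. by elim: l F => //= x l IH F; rewrite IH. Qed.

Variables (stop : pred (seq T)) (b : seq T -> T).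
Variables (stop' : pred (seq T')) (b' : seq T' -> T').
Hypothesis stop_nil : stop [::].
Hypothesis stop_map : forall l, stop' (map A l) = stop l.
Hypothesis b_map : forall l, ~~ stop l -> b' (map A l) = A (b l).

Let stop_nil' : stop' [::].
Proof. by rewrite (stop_map [::]). Qed.

Lemma sd_map F l : sd stop' b' F (map A l) = sd stop b (F \o map A) l.
Proof.
elim/facet_wf_ind: l F => l IH F; have [sl|sl] := boolP (stop l).
  by rewrite !sd_stop // stop_map.
rewrite (sd_cone b' stop_nil') ?stop_map // (sd_cone b stop_nil) //.
rewrite size_map bd_map; congr (_ * _).
apply: eq_bd => l1 l1l; rewrite /= IH // b_map //.
by apply: (sd_ext stop_nil) => l' _; rewrite /cone_dual /= map_rcons.
Qed.

Lemma htp_map F l : htp stop' b' F (map A l) = htp stop b (F \o map A) l.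
Proof.
elim/facet_wf_ind: l F => l IH F; have [sl|sl] := boolP (stop l).
  by rewrite !htp_stop // stop_map.
rewrite (htp_cone b' stop_nil') ?stop_map // (htp_cone b stop_nil) //.
rewrite size_map bd_map /= map_rcons b_map //.
congr (_ * (_ - _)); apply: eq_bd => l1 l1l; rewrite /= IH //.
by apply: (htp_ext stop_nil) => l' _; rewrite /cone_dual /= map_rcons.
Qed.

Lemma sd_iter_map N F l :
  sd_iter stop' b' N F (map A l) = sd_iter stop b N (F \o map A) l.
Proof.
elim: N l => //= N IH l; rewrite sd_map.
by apply: (sd_ext stop_nil) => l' _; apply: IH.
Qed.

Lemma htp_iter_map N F l :
  htp_iter stop' b' N F (map A l) = htp_iter stop b N (F \o map A) l.
Proof.
elim: N l => //= N IH l; rewrite htp_map sd_map; congr (_ + _).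
by apply: (sd_ext stop_nil) => l' _; apply: IH.
Qed.

Lemma sd_piece_map l (l2 : seq T') : sd_piece stop' b' (map A l) l2 ->
  exists2 l1, sd_piece stop b l l1 & l2 = map A l1.
Proof.
elim/facet_wf_ind: l l2 => l IH l2 p; have [sl|sl] := boolP (stop l).
  rewrite -stop_map in sl; rewrite (sd_piece_at_stop sl p).
  by exists l => //; constructor; rewrite -stop_map.
inversion p as [m sm|m l1' l2' _ f p']; subst.
  by rewrite stop_map (negbTE sl) in sm.
have [l1 l1l e] := facet_map f; rewrite e in p'.
have [u l1u ->] := IH _ l1l _ p'; exists (rcons u (b l)).
  exact: sd_piece_cone l1u.
by rewrite map_rcons b_map.
Qed.

Lemma stable_map N l : stable stop b N l -> stable stop' b' N (map A l).
Proof.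
elim: N l => [|N IH] l; first by rewrite /= stop_map.
by move=> /= st _ /sd_piece_map [l1 /st/IH ? ->].
Qed.

Variables (st_ex : forall l, exists N, stable stop b N l).
Variables (st_ex' : forall (l : seq T'), exists N, stable stop' b' N l).

Lemma fine_sd_map F l :
  fine_sd st_ex' F (map A l) = fine_sd st_ex (F \o map A) l.
Proof.
rewrite (fine_sdE stop_nil' st_ex' (N := depth st_ex l)) ?sd_iter_map //.
by apply: stable_map; apply: depthP.
Qed.

Lemma fine_htp_map F l :
  fine_htp st_ex' F (map A l) = fine_htp st_ex (F \o map A) l.
Proof.
rewrite (fine_htpE stop_nil' st_ex' (N := depth st_ex l)) ?htp_iter_map //.
by apply: stable_map; apply: depthP.
Qed.

End Naturality.

(** * Cells of the blow-up and signs of its differential *)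

Section CellPairs.
Variables (m n : nat) (la : {ffun 'I_m.+1 -> 'I_n.+1}).
Implicit Types (F : {set 'I_m.+1}) (e : {set 'I_n.+1}) (c d : cell la).
Implicit Types (f : {ffun 'I_n.+1 -> coneface m}).

Definition label_part F i : {set 'I_m.+1} := [set v in F | la v == i].

(** A cell of the blow-up is described by the set F of its vertices in Delta and
    the set e of the factors in which it contains the apex. *)
Definition cell_fun F e : {ffun 'I_n.+1 -> coneface m} :=
  [ffun i => (label_part F i, i \in e)].

Definition cell_verts f : {set 'I_m.+1} := [set v | v \in (f (la v)).1].
Definition cell_apexes f : {set 'I_n.+1} := [set i | (f i).2].

Definition legal F e : bool :=
  (ord_max \notin e) && [forall i, (i \in e) || (label_part F i != finset.set0)].

Lemma is_cell_cell_fun F e : is_cell la (cell_fun F e) = legal F e.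
Proof.
rewrite /is_cell /legal andbC ffunE; congr (_ && _).
apply: eq_forallb => i; rewrite ffunE /= orbC.
suff -> : label_part F i \subset [pred v | la v == i] by [].
by apply/fintype.subsetP => v; rewrite !inE => /andP[].
Qed.

Lemma cell_funK c : cell_fun (cell_verts (val c)) (cell_apexes (val c)) = val c.
Proof.
have /andP[/forallP cP _] := valP c.
apply/ffunP => i; rewrite ffunE [RHS]surjective_pairing; congr (_, _).
  have /andP[/fintype.subsetP sub _] := cP i.
  apply/setP => v; rewrite !inE; apply/andP/idP => [[vc /eqP <-]//|vc].
  have /eqP lv : la v == i by have := sub _ vc; rewrite inE.
  by rewrite lv vc eqxx.
by rewrite inE.
Qed.

Lemma cell_verts_cell_fun F e : cell_verts (cell_fun F e) = F.
Proof. by apply/setP => v; rewrite !inE ffunE !inE eqxx andbT. Qed.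

Lemma cell_apexes_cell_fun F e : cell_apexes (cell_fun F e) = e.
Proof. by apply/setP => v; rewrite !inE ffunE. Qed.

Lemma legal_cell c : legal (cell_verts (val c)) (cell_apexes (val c)).
Proof. by rewrite -is_cell_cell_fun cell_funK; apply: valP. Qed.

Definition mkcell F e (h : legal F e) : cell la :=
  Sub (cell_fun F e) (etrans (is_cell_cell_fun F e) h).

Lemma val_mkcell F e (h : legal F e) : val (mkcell h) = cell_fun F e.
Proof. by rewrite SubK. Qed.

Lemma mkcellK c (h : legal (cell_verts (val c)) (cell_apexes (val c))) : mkcell h = c.
Proof. by apply: val_inj; rewrite val_mkcell cell_funK. Qed.

Lemma coneface_dim_cell_fun i F e : legal F e ->
  (coneface_dim (cell_fun F e i)).+1 = (#|label_part F i| + (i \in e))%N.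
Proof.
move=> /andP[_ /forallP/(_ i)]; rewrite /coneface_dim ffunE /= => H.
rewrite prednK //; case: (i \in e) H => /=; first by rewrite addn1.
by rewrite addn0 card_gt0.
Qed.

Section Extension.
Variables (R : comPzRingType) (w : blowup R la).

(** Coordinates of a blow-up cochain, extended by 0 to pairs that are not cells. *)
Definition extend F e : R :=
  if insub (cell_fun F e) is Some c then w c else 0.

Lemma extendE F e (h : legal F e) : extend F e = w (mkcell h).
Proof.
rewrite /extend insubT => [|h']; first by rewrite is_cell_cell_fun.
by congr (w _); apply: val_inj; rewrite !SubK.
Qed.

Lemma extend0 F e : ~~ legal F e -> extend F e = 0.
Proof. by move=> h; rewrite /extend insubN // is_cell_cell_fun. Qed.

Lemma extend_val c : extend (cell_verts (val c)) (cell_apexes (val c)) = w c.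
Proof. by rewrite (extendE (legal_cell c)) mkcellK. Qed.

Lemma sum_cell F e (a : R) :
  \sum_c (if val c == cell_fun F e then a * w c else 0) = a * extend F e.
Proof.
have [h|h] := boolP (legal F e); last first.
  rewrite extend0 // mulr0 big1 // => c _; case: eqP => // ce.
  by move: (valP c); rewrite ce is_cell_cell_fun (negbTE h).
rewrite (extendE h) (bigD1 (mkcell h)) //= eqxx big1 ?addr0 // => c cn.
case: eqP => // ce; case/negP: cn; apply/eqP; apply: val_inj.
by rewrite val_mkcell.
Qed.

End Extension.

(** Exponents of the signs with which the two kinds of facets, omission of the
    vertex v and omission of the apex of the factor i, enter the tensor product
    differential. *)
Definition vertex_exp F e v : nat :=
  let f := cell_fun (F :\ v) e in
  (\sum_(j < n.+1 | (j < la v)%N) coneface_dim (f j) +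
   (coneface_dim (f (la v))).+1 + #|[pred w in label_part F (la v) | (w < v)%N]|)%N.

Definition apex_exp F e i : nat :=
  let f := cell_fun F (e :\ i) in
  (\sum_(j < n.+1 | (j < i)%N) coneface_dim (f j) +
   (coneface_dim (f i)).+1 + #|label_part F i|)%N.

Lemma vertex_facetE F e c v : v \in F ->
  ([forall j, (j != la v) ==> (val c j == cell_fun F e j)] &&
   (val c (la v) == (label_part F (la v) :\ v, la v \in e))) =
  (val c == cell_fun (F :\ v) e).
Proof.
move=> vF; apply/andP/eqP => [[/forallP H /eqP H1]|->].
  apply/ffunP => j; rewrite ffunE; have [->|jv] := eqVneq j (la v).
    rewrite H1; congr (_, _); apply/setP => w; rewrite !inE.
    by rewrite andbA.
  have := H j; rewrite jv => /eqP ->; rewrite ffunE; congr (_, _).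
  apply/setP => w; rewrite !inE; case: (eqVneq w v) => //= ->.
  by rewrite eq_sym (negbTE jv) andbF.
split; last first.
  by rewrite ffunE; apply/eqP; congr (_, _); apply/setP => w; rewrite !inE andbA.
apply/forallP => j; apply/implyP => jv; rewrite !ffunE; apply/eqP; congr (_, _).
apply/setP => w; rewrite !inE; case: (eqVneq w v) => //= ->.
by rewrite eq_sym (negbTE jv) andbF.
Qed.

Lemma apex_facetE F e c i : i \in e ->
  ([forall j, (j != i) ==> (val c j == cell_fun F e j)] &&
   (val c i == (label_part F i, false))) = (val c == cell_fun F (e :\ i)).
Proof.
move=> ie; apply/andP/eqP => [[/forallP H /eqP H1]|->].
  apply/ffunP => j; rewrite ffunE; have [->|jv] := eqVneq j i.
    by rewrite H1 !inE eqxx.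
  by have := H j; rewrite jv => /eqP ->; rewrite ffunE !inE jv.
split; last by rewrite ffunE !inE eqxx.
by apply/forallP => j; apply/implyP => jv; rewrite !ffunE !inE jv.
Qed.


(** A cell occurs in the coboundary only through a facet of one of its factors:
    either a vertex of F or an apex is omitted. *)
Lemma tensor_cobd_coefE c F e (h : legal F e) :
  tensor_cobd_coef c (mkcell h) =
  \sum_(v in F) (if val c == cell_fun (F :\ v) e then (-1) ^+ vertex_exp F e v else 0) +
  \sum_(i in e) (if val c == cell_fun F (e :\ i) then (-1) ^+ apex_exp F e i else 0).
Proof.
rewrite /tensor_cobd_coef val_mkcell.
under eq_bigr => i _ do rewrite /cobd_coef /bd_coef mulrDr mulrDr.
rewrite big_split /=; congr (_ + _).
  rewrite (partition_big (fun v => la v) xpredT) //= big_mkcond.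
  apply: eq_bigr => i _; case: ifP => agree; last first.
    rewrite big1 // => v /andP[vF /eqP lv]; case: ifP => // .
    by rewrite -vertex_facetE // lv agree.
  rewrite !mulr_sumr big_mkcondr [RHS]big_mkcondr [RHS]big_mkcond.
  rewrite [LHS]big_mkcond; apply: eq_bigr => v _.
  rewrite ffunE /= inE; case: (boolP (v \in F)) => //= vF.
  have [lv|//] := eqVneq (la v) i; rewrite -vertex_facetE // lv agree /=.
  case: ifP => // cE.
  have cmk : val c = cell_fun (F :\ v) e by apply/eqP; rewrite -vertex_facetE // lv agree.
  by rewrite /vertex_exp lv -cmk !exprD exprS mulN1r mulrA.
rewrite big_mkcond [RHS]big_mkcond; apply: eq_bigr => i _.
rewrite ffunE /=; case: (boolP (i \in e)) => /= ie; last first.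
  by case: ifP => //; rewrite !mulr0.
have := apex_facetE F c ie; case: ifP => /= [ag <-|_ <- //].
case: ifP => [cE|_]; last by rewrite !mulr0.
have cmk : val c = cell_fun F (e :\ i).
  by apply/eqP; rewrite -apex_facetE // ag cE.
by rewrite /apex_exp -cmk !exprD exprS mulN1r mulrA.
Qed.

Lemma blowup_diffE (R : comPzRingType) (w : blowup R la) F e (h : legal F e) :
  blowup_diff w (mkcell h) =
  \sum_(v in F) (-1) ^+ vertex_exp F e v * extend w (F :\ v) e +
  \sum_(i in e) (-1) ^+ apex_exp F e i * extend w F (e :\ i).
Proof.
rewrite ffunE.
have E c : (tensor_cobd_coef c (mkcell h))%:~R * w c =
  \sum_(v in F)
    (if val c == cell_fun (F :\ v) e then (-1) ^+ vertex_exp F e v * w c else 0) +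
  \sum_(i in e)
    (if val c == cell_fun F (e :\ i) then (-1) ^+ apex_exp F e i * w c else 0).
  rewrite tensor_cobd_coefE rmorphD /= !rmorph_sum mulrDl !mulr_suml /=.
  by congr (_ + _); apply: eq_bigr => i _; case: ifP => _;
    rewrite ?rmorph0 ?mul0r // rmorphXn rmorphN1.
under eq_bigr => c _ do rewrite E.
rewrite big_split /= exchange_big /=; congr (_ + _).
  by apply: eq_bigr => v _; rewrite sum_cell.
by rewrite exchange_big /=; apply: eq_bigr => i _; rewrite sum_cell.
Qed.

(** The normalisation of signs.  When a vertex of label i is omitted, the i-th
    term changes by k + #{j in e, j <= i} + i + 1 modulo 2, where k is the
    number of vertices of label i; this is the defect between the Koszul sign of
    the tensor product and the sign of the facet in the join.  The binomial
    coefficient is there for the summand k. *)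
Definition norm_exp F e : nat :=
  (\sum_i ('C(#|label_part F i|.+1, 2) +
           #|label_part F i| * (#|[set j in e | (j <= i)%N]| + i.+1)))%N.

Lemma sum_dim (P : pred 'I_n.+1) F e : legal F e ->
  (\sum_(j | P j) coneface_dim (cell_fun F e j) + #|P| =
   \sum_(j | P j) #|label_part F j| + #|[set j in e | P j]|)%N.
Proof.
move=> h; rewrite -[X in (_ + X)%N]sum1_card -big_split /=.
under eq_bigr => j _ do rewrite addn1 (coneface_dim_cell_fun _ h).
rewrite big_split /=; congr (_ + _)%N.
rewrite -sum1_card big_mkcond [RHS]big_mkcond; apply: eq_bigr => j _.
by rewrite inE andbC; case: (P j); case: (j \in e).
Qed.

Lemma card_below (i : 'I_n.+1) : #|[pred j : 'I_n.+1 | (j < i)%N]| = i.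
Proof.
rewrite -sum1_card.
have := @big_ord_widen _ 0%N addn _ n.+1 (fun=> 1%N) (ltnW (ltn_ord i)).
by move=> <-; rewrite sum1_card card_ord.
Qed.

Lemma sum_dim_below F e (i : 'I_n.+1) : legal F e ->
  (\sum_(j < n.+1 | (j < i)%N) coneface_dim (cell_fun F e j) + i =
   \sum_(j < n.+1 | (j < i)%N) #|label_part F j| +
   #|[set j in e | (j < i)%N]|)%N.
Proof.
by move=> h; have := sum_dim [pred j : 'I_n.+1 | (j < i)%N] h; rewrite card_below.
Qed.

Lemma card_upto e (i : 'I_n.+1) :
  #|[set j in e | (j <= i)%N]| = (#|[set j in e | (j < i)%N]| + (i \in e))%N.
Proof.
rewrite (cardsD1 i) inE leqnn andbT addnC; congr (_ + _)%N.
by apply: eq_card => j; rewrite !inE ltn_neqAle -val_eqE /=; case: (j \in e);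
   rewrite ?andbF ?andbT.
Qed.

Lemma card_label_part F : #|F| = (\sum_i #|label_part F i|)%N.
Proof.
rewrite -sum1_card (partition_big (fun v => la v) xpredT) //=.
by apply: eq_bigr => i _; rewrite -sum1_card; apply: eq_bigl => v; rewrite inE.
Qed.

Lemma label_part_setD1 F v i : i != la v -> label_part (F :\ v) i = label_part F i.
Proof.
move=> iv; apply/setP => w; rewrite !inE; case: (eqVneq w v) => //= ->.
by rewrite eq_sym (negbTE iv) andbF.
Qed.

Lemma card_label_part_setD1 F v : v \in F ->
  #|label_part F (la v)| = #|label_part (F :\ v) (la v)|.+1.
Proof.
move=> vF; rewrite (cardsD1 v) inE vF eqxx /= add1n; congr _.+1.
by apply: eq_card => w; rewrite !inE andbA.
Qed.

Lemma odd_eq a b x y : (a + x.*2 = b + y.*2)%N -> odd a = odd b.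
Proof. by move=> /(congr1 odd); rewrite !oddD !odd_double !addbF. Qed.

(** After normalisation, omitting a vertex has the sign of the simplicial
    boundary of the whole simplex F.  Monotonicity of the labels enters through
    the count of the vertices of F preceding v: they are the vertices of smaller
    label and the earlier ones of the same label. *)
Lemma vertex_sign F e v : {homo la : v w / (v <= w)%N} -> v \in F ->
  legal F e -> legal (F :\ v) e ->
  odd (vertex_exp F e v + norm_exp F e + norm_exp (F :\ v) e) =
  odd #|[set w in F | (w < v)%N]|.
Proof.
move=> la_homo vF h h'; set i := la v.
have e1 := sum_dim_below i h'.
have e2 := coneface_dim_cell_fun i h'; have e3 := card_label_part_setD1 vF.
have e4 : #|[set w in F | (w < v)%N]| =
    (\sum_(j < n.+1 | (j < i)%N) #|label_part (F :\ v) j| +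
     #|[pred w in label_part F i | (w < v)%N]|)%N.
  rewrite -sum1_card (partition_big (fun v => la v) (fun j => j <= i)%N) /=; last first.
    by move=> w; rewrite inE => /andP[_ /ltnW/la_homo].
  rewrite (bigD1 i) //= addnC; congr (_ + _)%N; last first.
    rewrite -sum1_card; apply: eq_bigl => w.
    by rewrite !inE andbAC.
  apply: eq_big => [j|j /andP[ji jn]]; first by rewrite -val_eqE /= ltn_neqAle andbC.
  rewrite label_part_setD1 // -sum1_card; apply: eq_bigl => w; rewrite !inE.
  case: eqP => [lw|]; rewrite ?andbF // andbT; case: (w \in F) => //=.
  rewrite ltnNge; apply/negP => /la_homo; rewrite lw -/i => ij.
  by move/negP: jn; apply; apply/eqP; apply: val_inj; apply/eqP; rewrite eqn_leq ji.
pose trm G j := ('C(#|label_part G j|.+1, 2) +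
  #|label_part G j| * (#|[set l in e | (l <= j)%N]| + j.+1))%N.
have e5 G : norm_exp G e = (trm G i + \sum_(j < n.+1 | j != i) trm G j)%N.
  by rewrite /norm_exp (bigD1 i).
have e6 : (\sum_(j < n.+1 | j != i) trm F j =
    \sum_(j < n.+1 | j != i) trm (F :\ v) j)%N.
  by apply: eq_bigr => j ji; rewrite /trm (label_part_setD1 F ji).
rewrite e4 /vertex_exp -/i e2 !e5 e6.
move: (\sum_(j < n.+1 | j != i) trm _ j)%N => T; rewrite /trm.
rewrite e3 -/i card_upto binS bin1.
move: e1; set A := (\sum_(j < n.+1 | _) coneface_dim _)%N.
set K := (\sum_(j < n.+1 | _) _)%N; set E := #|_| => e1.
set k := #|label_part _ _|; set p := #|[pred _ in _ | _]|.
set B := 'C(_, _); set ei : nat := i \in e.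
apply: (@odd_eq _ _ 0 (E + ei + k.+1 + T + B + k * (E + ei + i.+1))).
rewrite -!muln2; nia.
Qed.

(** After normalisation, the sign with which an apex is omitted depends on F
    only through the parity of its cardinal. *)
Lemma apex_sign_parity F e i : i \in e -> legal F e -> legal F (e :\ i) ->
  odd (apex_exp F e i + norm_exp F e + norm_exp F (e :\ i)) =
  odd (#|F| + (#|[set j in e | (j < i)%N]| + i)).
Proof.
move=> ie h h'; have e1 := sum_dim_below i h'; have e2 := coneface_dim_cell_fun i h'.
have e3 : #|[set j in e :\ i | (j < i)%N]| = #|[set j in e | (j < i)%N]|.
  apply: eq_card => j; rewrite !inE; case: (eqVneq j i) => // ->.
  by rewrite ltnn !andbF.
have e4 : norm_exp F e =
    (norm_exp F (e :\ i) + \sum_(j < n.+1 | (i <= j)%N) #|label_part F j|)%N.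
  rewrite /norm_exp [X in (_ + X)%N]big_mkcond -big_split /=; apply: eq_bigr => j _.
  have -> : #|[set l in e | (l <= j)%N]| =
      (#|[set l in e :\ i | (l <= j)%N]| + (i <= j)%N)%N.
    rewrite (cardsD1 i) inE ie addnC /=; congr (_ + _)%N.
    by apply: eq_card => l; rewrite !inE andbA.
  by case: leqP => _; rewrite /=; ring.
have e5 : #|F| = (\sum_(j < n.+1 | (j < i)%N) #|label_part F j| +
                  \sum_(j < n.+1 | (i <= j)%N) #|label_part F j|)%N.
  rewrite card_label_part (bigID (fun j : 'I_n.+1 => (j < i)%N)) /=; congr (_ + _)%N.
  by apply: eq_bigl => j; rewrite -leqNgt.
rewrite e4 e5 /apex_exp; move: e1 e2; rewrite e3 !inE eqxx /= addn0.
move: (coneface_dim (cell_fun F (e :\ i) i)) (norm_exp F (e :\ i)) => D S.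
move: (\sum_(j < n.+1 | _) coneface_dim _)%N => A.
move: (\sum_(j < n.+1 | (i <= j)%N) _)%N (\sum_(j < n.+1 | _) _)%N => Kge K.
move: #|label_part F i| #|[set j in e | (j < i)%N]| (nat_of_ord i) => k E q e1 e2.
by apply: (@odd_eq _ _ q (k + S)); rewrite -!muln2; lia.
Qed.

End CellPairs.

(** * Convexity, barycentres and hulls in the standard simplex *)

Local Open Scope classical_set_scope.
Local Open Scope ring_scope.

Section Convex.
Variable RR : realType.

Definition convex n (C : set 'rV[RR]_n) : Prop :=
  forall x y (a : RR), 0 <= a -> a <= 1 -> C x -> C y ->
    C (a *: x + (1 - a) *: y).

Lemma convex_sum n (C : set 'rV[RR]_n) (I : eqType) (r : seq I) (P : pred I)
    (t : I -> RR) (x : I -> 'rV[RR]_n) :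
  convex C -> (forall i, P i -> 0 <= t i) -> (forall i, P i -> C (x i)) ->
  \sum_(i <- r | P i) t i = 1 -> C (\sum_(i <- r | P i) t i *: x i).
Proof.
move=> cC t0 Cx t1.
suff H s : \sum_(i <- s | P i) t i != 0 ->
    C ((\sum_(i <- s | P i) t i)^-1 *: \sum_(i <- s | P i) t i *: x i).
  by have := H r; rewrite t1 oner_neq0 invr1 scale1r; apply.
elim: s => [|i s IH]; rewrite ?big_nil ?eqxx // !big_cons.
have [Pi|//] := boolP (P i).
set S := \sum_(j <- s | P j) t j in IH *.
set X := \sum_(j <- s | P j) _ in IH *.
have S0 : 0 <= S by apply: sumr_ge0.
have ti0 := t0 _ Pi => tS.
have tS0 : 0 < t i + S by rewrite lt_neqAle eq_sym tS addr_ge0.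
have [S00|S00] := eqVneq S 0.
  have X0 : X = 0.
    rewrite /X big_seq_cond big1 // => j /andP[js Pj].
    have : \sum_(j <- s | P j) t j == 0 by rewrite -/S S00.
    rewrite psumr_eq0 // => /allP/(_ _ js); rewrite Pj => /eqP ->.
    by rewrite scale0r.
  rewrite S00 X0 !addr0 scalerA mulVf ?scale1r; first exact: Cx.
  by rewrite S00 addr0 in tS.
have := cC _ _ (t i / (t i + S)) _ _ (Cx _ Pi) (IH S00).
have -> : t i / (t i + S) *: x i + (1 - t i / (t i + S)) *: (S^-1 *: X) =
    (t i + S)^-1 *: (t i *: x i + X).
  rewrite scalerDr !scalerA; congr (_ *: _ + _ *: _); first by rewrite mulrC.
  by field; rewrite S00 tS.
apply; first by rewrite divr_ge0 // ltW.
by rewrite ler_pdivrMr // mul1r lerDl.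
Qed.

Lemma convex_stdsimplex m : convex (stdsimplex RR m).
Proof.
move=> x y a a0 a1 [x0 x1] [y0 y1]; split=> [v|].
  by rewrite !mxE addr_ge0 // mulr_ge0 // subr_ge0.
under eq_bigr do rewrite !mxE.
by rewrite big_split /= -!mulr_sumr x1 y1 !mulr1 addrC subrK.
Qed.

Lemma convex_linear n k (M : 'M[RR]_(n, k)) (C : set 'rV_k) :
  convex C -> convex [set x | C (x *m M)].
Proof.
move=> cC x y a a0 a1 /= Cx Cy.
by rewrite mulmxDl -!scalemxAl; apply: cC.
Qed.

Lemma convex_ball n (c : 'rV[RR]_n.+1) M : convex [set x | `|x - c| <= M].
Proof.
move=> x y a a0 a1 /= xM yM.
have -> : a *: x + (1 - a) *: y - c = a *: (x - c) + (1 - a) *: (y - c).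
  by apply/rowP => i; rewrite !mxE; ring.
rewrite (le_trans (ler_normD _ _)) // !normrZ !ger0_norm ?subr_ge0 //.
have -> : M = a * M + (1 - a) * M by ring.
by rewrite lerD // ler_wpM2l // subr_ge0.
Qed.

End Convex.

Section Topology.
Variable RR : realType.

Lemma mulmx_continuous n k (M : 'M[RR]_(n.+1, k.+1)) :
  continuous (fun t : 'rV[RR]_n.+1 => t *m M).
Proof.
have -> : (fun t : 'rV[RR]_n.+1 => t *m M) =
    (fun u => \sum_i u ord0 i *: row i M).
  by apply/funext => u; rewrite mulmx_sum_row.
apply: continuous_big => [|i _ t]; first exact: add_continuous.
by apply: (@cvgZr_tmp _ _ _ (nbhs t)); apply: coord_continuous.
Qed.

Lemma norm_stdsimplex m (t : 'rV[RR]_m.+1) : stdsimplex RR m t -> `|t| <= 1.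
Proof.
move=> [t0 t1]; rewrite [leLHS]/Num.norm /= mx_normrE.
apply/bigmax_leP; split=> // -[i j] _ /=.
by rewrite ord1 ger0_norm // -t1 (bigD1 j) //= lerDl sumr_ge0.
Qed.

Lemma compact_stdsimplex m : compact (stdsimplex RR m).
Proof.
apply: bounded_closed_compact.
  exists 1; split; first by rewrite num_real.
  by move=> M M1 t st; apply: le_trans (ltW M1); apply: norm_stdsimplex.
rewrite (_ : stdsimplex RR m =
  (\bigcap_v [set t : 'rV[RR]_m.+1 | 0 <= t ord0 v]) `&`
  [set t : 'rV[RR]_m.+1 | \sum_v t ord0 v = 1]); last first.
  apply/seteqP; split=> t /= [t0 t1]; split=> // v; first by move=> _; apply: t0.
  exact: t0.
apply: closedI.
  apply: closed_bigI => v _.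
  apply: (@closed_comp _ _ (fun t : 'rV[RR]_m.+1 => t ord0 v) [set x | 0 <= x]).
    by move=> t _; apply: coord_continuous.
  exact: closed_ge.
apply: (@closed_comp _ _ (fun t : 'rV[RR]_m.+1 => \sum_v t ord0 v) [set x | x = 1]).
  move=> t _; apply: continuous_big => [|i _ u]; first exact: add_continuous.
  exact: coord_continuous.
exact: closed_eq.
Qed.

(** Compactness as a near-covering property: a radius works near each point. *)
Lemma lebesgue_number m (K : set 'rV[RR]_m.+1) (O : set (set 'rV[RR]_m.+1)) :
  compact K -> (forall o, O o -> open o) ->
  (forall x, K x -> exists2 o, O o & o x) ->
  exists2 e, 0 < e & forall x, K x -> exists2 o, O o &
    forall y, `|y - x| <= e -> o y.
Proof.
move=> cK Oo KO.
have : \forall e \near (0 : RR)^'+, K `<=` [set x | exists2 o, O o &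
    forall y : 'rV[RR]_m.+1, `|y - x| <= e -> o y].
  apply: (iffLR (compact_near_coveringP K) cK) => x /KO [V OV Vx].
  have /nbhs_ballP[r /= r0 ro] : nbhs x V.
    by apply: open_nbhs_nbhs; split=> //; apply: Oo.
  exists (ball x (r / 2), [set e | e < r / 2]).
    split => /=; first by apply: nbhsx_ballx; rewrite divr_gt0.
    by apply: nbhs_right_lt; rewrite divr_gt0.
  move=> [y e] /= [xy er]; exists V => // z ze.
  apply: ro; rewrite -ball_normE /= in xy *.
  rewrite -(subrK y x) -addrA (le_lt_trans (ler_normD _ _)) //.
  rewrite (splitr r) ltrD // distrC (le_lt_trans ze) //.
move=> H; near (0 : RR)^'+ => e.
exists e => [|x Kx]; first by near: e; apply: nbhs_right_gt.
by move: x Kx; near: e.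
Unshelve. all: by end_near. Qed.

End Topology.

Section Points.
Variables (RR : realType) (m : nat).
Local Notation pt := (stdsimplex RR m).

Implicit Types (x y z : pt) (l u : seq pt).

Lemma pointP x : stdsimplex RR m (val x).
Proof. exact: set_mem (valP x). Qed.

Definition to_point (z : 'rV[RR]_m.+1) (h : stdsimplex RR m z) : pt :=
  exist _ z (mem_set h).

Lemma vertexP (v : 'I_m.+1) : stdsimplex RR m (delta_mx ord0 v).
Proof.
split=> [w|]; first by rewrite mxE ler0n.
rewrite (bigD1 v) //= mxE !eqxx big1 ?addr0 // => w /negbTE wv.
by rewrite mxE wv andbF.
Qed.

Definition vertex (v : 'I_m.+1) : pt := to_point (vertexP v).

Definition avg l : 'rV[RR]_m.+1 :=
  \sum_(x <- l) (size l)%:R^-1 *: val x.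

(** The default value is only taken for the empty list. *)
Definition bary l : pt := insubd (vertex ord0) (avg l).

Lemma avg_convex (C : set 'rV[RR]_m.+1) l : convex C -> l != [::] ->
  (forall x, x \in l -> C (val x)) -> C (avg l).
Proof.
move=> cC l0 Cl; rewrite /avg big_seq.
apply: (@convex_sum _ _ _ _ _ (fun x => x \in l) (fun=> (size l)%:R^-1)) => //.
rewrite -big_seq big_const_seq count_predT iter_addr_0 -[LHS]mulr_natr.
by rewrite mulVf ?pnatr_eq0 ?size_eq0.
Qed.

Lemma val_bary l : l != [::] -> val (bary l) = avg l.
Proof.
move=> l0; rewrite /bary val_insubd mem_set //.
by apply: avg_convex => // [|x _]; [apply: convex_stdsimplex | apply: pointP].
Qed.

(** Defined by its universal property; for non-empty lists [hull_comb] gives the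
    description by convex combinations. *)
Definition hull l : set pt :=
  [set x | forall C : set 'rV[RR]_m.+1, convex C ->
    (forall y, y \in l -> C (val y)) -> C (val x)].

Lemma hull_mem l x : x \in l -> hull l x.
Proof. by move=> xl C _; apply. Qed.

Lemma hull_bary l : l != [::] -> hull l (bary l).
Proof. by move=> l0 C cC Cl; rewrite val_bary //; apply: avg_convex. Qed.

Lemma hull_sub l u : (forall x, x \in u -> hull l x) -> hull u `<=` hull l.
Proof. by move=> ul x ux C cC Cl; apply: ux => // y /ul; apply. Qed.

Lemma convex_hull l : convex (val @` hull l).
Proof.
move=> _ _ a a0 a1 [y ly <-] [z lz <-].
exists (to_point (convex_stdsimplex a0 a1 (pointP y) (pointP z))) => // C cC Cl.
by apply: (cC) => //; [apply: (ly C)|apply: (lz C)].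
Qed.

Definition near_set (C : set 'rV[RR]_m.+1) (M : RR) : set 'rV[RR]_m.+1 :=
  [set z | exists2 p, C p & `|z - p| <= M].

Lemma convex_near_set (C : set 'rV[RR]_m.+1) M : convex C -> convex (near_set C M).
Proof.
move=> cC x y a a0 a1 [p Cp xp] [q Cq yq].
exists (a *: p + (1 - a) *: q); first exact: cC.
have -> : a *: x + (1 - a) *: y - (a *: p + (1 - a) *: q) =
    a *: (x - p) + (1 - a) *: (y - q).
  by apply/rowP => i; rewrite !mxE; ring.
rewrite (le_trans (ler_normD _ _)) // !normrZ !ger0_norm ?subr_ge0 //.
have -> : M = a * M + (1 - a) * M by ring.
by rewrite lerD // ler_wpM2l // subr_ge0.
Qed.

(** If one of at most K points lies in the convex set C and the others are at
    distance at most M from it, then averaging gains the factor 1 - 1/K.  With C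
    a singleton this is the usual estimate for barycentric subdivision. *)
Lemma avg_near (C : set 'rV[RR]_m.+1) (M : RR) K l x0 :
  convex C -> 0 <= M -> (size l <= K)%N -> x0 \in l -> C (val x0) ->
  (forall x, x \in l -> near_set C M (val x)) ->
  near_set C ((1 - K%:R^-1) * M) (avg l).
Proof.
move=> cC M0 lK x0l Cx0 Cl.
have l0 : (0 < size l)%N by case: l x0l {lK Cl}.
have [q qP] : exists q : pt -> 'rV[RR]_m.+1, forall x, x \in l ->
    C (q x) /\ `|val x - q x| <= if x == x0 then 0 else M.
  suff /choice [q qP] : forall x, exists z : 'rV_m.+1, x \in l ->
    C z /\ `|val x - z| <= if x == x0 then 0 else M by exists q.
  move=> x; have [->|xx0] := eqVneq x x0.
    by exists (val x0) => _; rewrite subrr normr0.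
  have [/Cl [z Cz xz]|_] := boolP (x \in l); last by exists 0.
  by exists z.
exists (\sum_(x <- l) (size l)%:R^-1 *: q x).
  rewrite big_seq.
  apply: (@convex_sum _ _ _ _ _ (fun x => x \in l) (fun=> (size l)%:R^-1)) => //.
    by move=> x /qP [].
  rewrite -big_seq big_const_seq count_predT iter_addr_0 -[LHS]mulr_natr.
  by rewrite mulVf ?pnatr_eq0 -?lt0n.
rewrite /avg -sumrB (le_trans (ler_norm_sum _ _ _)) //.
apply: (@le_trans _ _
    (\sum_(x <- l) (size l)%:R^-1 * (if x == x0 then 0 else M))).
  rewrite big_seq [leRHS]big_seq; apply: ler_sum => x xl.
  rewrite -scalerBr normrZ ger0_norm ?invr_ge0 ?ler0n //.
  by rewrite ler_wpM2l ?invr_ge0 ?ler0n //; have [] := qP _ xl.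
rewrite -mulr_sumr (big_rem x0) //= eqxx add0r.
have le1 : \sum_(x <- rem x0 l) (if x == x0 then 0 else M) <= (size l).-1%:R * M.
  rewrite -(size_rem x0l) mulr_natl -[X in _ <= M *+ X]count_predT.
  rewrite -[leRHS]iter_addr_0 -big_const_seq; apply: ler_sum => x _.
  by case: ifP.
rewrite (le_trans (ler_wpM2l _ le1)) ?invr_ge0 ?ler0n // mulrA ler_wpM2r //.
have -> : (size l)%:R^-1 * (size l).-1%:R = 1 - (size l)%:R^-1 :> RR.
  by rewrite -subn1 natrB // mulrBr mulVf ?mulr1 // pnatr_eq0 -lt0n.
rewrite lerD2l lerN2 lef_pV2 ?posrE ?ltr0n //; last exact: leq_trans lK.
by rewrite ler_nat.
Qed.

End Points.

Section Combinations.
Variables (RR : realType) (m k : nat) (p : nat -> stdsimplex RR m).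
Implicit Type t : stdsimplex RR k.

Definition points_mx : 'M[RR]_(k.+1, m.+1) := \matrix_(i, j) val (p i) ord0 j.

Lemma row_points_mx i : row i points_mx = val (p i).
Proof. by apply/rowP => j; rewrite !mxE. Qed.

Lemma points_mxP (z : 'rV[RR]_k.+1) : stdsimplex RR k z ->
  forall C, convex C -> (forall i, (i <= k)%N -> C (val (p i))) -> C (z *m points_mx).
Proof.
move=> [z0 z1] C cC Cp; rewrite mulmx_sum_row.
by apply: convex_sum => // i _; rewrite row_points_mx; apply: Cp; rewrite -ltnS.
Qed.

Lemma combP t : stdsimplex RR m (val t *m points_mx).
Proof.
apply: points_mxP (pointP t) _ _ _; first exact: convex_stdsimplex.
by move=> *; apply: pointP.
Qed.

(** The affine map from the standard k-simplex sending its vertices to the p i. *)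
Definition comb t : stdsimplex RR m := to_point (combP t).

Lemma val_comb t : val (comb t) = val t *m points_mx.
Proof. by []. Qed.

Lemma comb_vertex i : comb (vertex RR i) = p i.
Proof. by apply: val_inj; rewrite /= -rowE row_points_mx. Qed.

Lemma mem_mkseq_le x : x \in mkseq p k.+1 -> exists2 i, (i <= k)%N & x = p i.
Proof. by move=> /mapP[i]; rewrite mem_iota => /andP[_ ik] ->; exists i. Qed.

Lemma hull_comb x : hull (mkseq p k.+1) x <-> exists t, x = comb t.
Proof.
split=> [hx|[t ->] C cC Cp]; last first.
  apply: points_mxP (pointP t) _ cC _ => i ik; apply: Cp.
  by apply: map_f; rewrite mem_iota.
have [z sz e] : ((fun z => z *m points_mx) @` stdsimplex RR k) (val x).
  apply: hx.
    move=> _ _ a a0 a1 [z sz <-] [w sw <-]; exists (a *: z + (1 - a) *: w).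
      exact: convex_stdsimplex.
    by rewrite mulmxDl !scalemxAl.
  move=> _ /mem_mkseq_le [i ik ->]; exists (delta_mx ord0 (inord i)).
    exact: vertexP.
  by rewrite -rowE row_points_mx inordK.
by exists (to_point sz); apply: val_inj.
Qed.

Lemma compact_hull : compact (val @` hull (mkseq p k.+1)).
Proof.
rewrite (_ : _ @` _ = (fun z => z *m points_mx) @` stdsimplex RR k).
  apply: continuous_compact; last exact: compact_stdsimplex.
  by apply: continuous_subspaceT => z; apply: mulmx_continuous.
apply/seteqP; split=> [_ [x /hull_comb[t ->] <-]|_ [z sz <-]].
  by exists (val t) => //; apply: pointP.
by exists (comb (to_point sz)) => //; apply/hull_comb; exists (to_point sz).
Qed.

Lemma comb_continuous : continuous comb.
Proof.
apply: continuous_comp_initial => t /=.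
have -> : set_val \o comb = (fun z => z *m points_mx) \o set_val by [].
apply: continuous_comp; first exact: initial_continuous.
exact: mulmx_continuous.
Qed.

End Combinations.

Section CombMap.
Variables (RR : realType) (m k : nat) (p : nat -> stdsimplex RR m).
Implicit Types (l : seq (stdsimplex RR k)).
Local Notation A := (comb (k := k) p).

Lemma avg_comb l : avg (map A l) = avg l *m points_mx k p.
Proof.
rewrite /avg size_map big_map mulmx_suml.
by apply: eq_bigr => x _; rewrite -scalemxAl.
Qed.

Lemma bary_comb l : l != [::] -> bary (map A l) = A (bary l).
Proof.
move=> l0; apply: val_inj; rewrite val_bary ?avg_comb /= ?val_bary //.
by case: l l0.
Qed.

Lemma hull_mapP l x : hull (map A l) x <-> exists2 y, hull l y & x = A y.
Proof.
split=> [h|[y ly ->] C cC Cl]; last first.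
  apply: (ly [set z | C (z *m points_mx k p)]); first exact: convex_linear.
  by move=> z zl; apply: (Cl (A z)); apply: map_f.
have [_ [y ly <-] e] : ((fun z => z *m points_mx k p) @` (val @` hull l)) (val x).
  apply: h.
    move=> _ _ a a0 a1 [y ly <-] [z lz <-].
    exists (a *: y + (1 - a) *: z); first exact: convex_hull.
    by rewrite mulmxDl !scalemxAl.
  move=> _ /mapP[y yl ->]; exists (val y) => //.
  by exists y => //; apply: hull_mem.
by exists y => //; apply: val_inj.
Qed.

End CombMap.

(** * Termination of the adaptive subdivision *)

Lemma facet_subset (T : eqType) (l1 l : seq T) :
  facet l1 l -> {subset l1 <= l}.
Proof.
elim=> [x u y yu|x u1 u _ IH y]; first by rewrite inE yu orbT.
by rewrite !inE => /orP[->//|/IH ->]; rewrite orbT.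
Qed.

Section Termination.
Variables (RR : realType) (m : nat) (OO : set (set 'rV[RR]_m.+1)).
Local Notation pt := (stdsimplex RR m).
Implicit Types (x y z : pt) (l u G E S : seq pt).

Definition small l : Prop :=
  exists2 V, OO V & forall x, hull l x -> V (val x).

Definition stop l : bool := (l == [::]) || `[< small l >].

Lemma stop_nil : stop [::].
Proof. by []. Qed.

Lemma stop_subset l1 l : {subset l1 <= l} -> stop l -> stop l1.
Proof.
move=> sub /orP[/eqP l0|/asboolP[V OV lV]].
  by apply/orP; left; case: l1 sub => // x l1 /(_ x (mem_head _ _)); rewrite l0.
apply/orP; right; apply/asboolP; exists V => // x xl1; apply: lV.
by apply: hull_sub xl1 => y /sub; apply: hull_mem.
Qed.

Lemma stop_facet l1 l : facet l1 l -> stop l -> stop l1.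
Proof. by move=> /facet_subset; apply: stop_subset. Qed.

Local Notation piece := (sd_piece stop (@bary RR m)).

Lemma nstop_nil l : ~~ stop l -> l != [::].
Proof. by apply: contra => /eqP ->. Qed.

Lemma sd_piece_hull l l' z : piece l l' -> z \in l' -> hull l z.
Proof.
move=> p; elim: p z => [u _ z|u u1 u2 nu f _ IH z]; first exact: hull_mem.
rewrite mem_rcons inE => /orP[/eqP ->|/IH].
  by apply: hull_bary; apply: nstop_nil.
by apply: hull_sub => y /(facet_subset f); apply: hull_mem.
Qed.

Definition between E G l :=
  [/\ {subset E <= G}, {subset G <= l}, (size G <= size l)%N & G != [::]].

(** A piece of l consists of a retained stopped face E of l followed by
    barycentres of larger faces, forming a flag above E.  Hence, of two vertices
    not both in E, one is the barycentre of a face whose hull contains the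
    other. *)
Lemma sd_piece_struct l l' : piece l l' -> exists E,
  [/\ stop E, {subset E <= l}, {subset E <= l'} & forall y z, y \in l' -> z \in l' ->
    (y \in E /\ z \in E) \/ exists G, between E G l /\
      ((y = bary G /\ hull G z) \/ (z = bary G /\ hull G y))].
Proof.
elim=> [u su|u u1 u2 nu f p [E [sE Eu1 Eu2 IH]]].
  by exists u; split=> // y z yu zu; left.
have u1u := facet_subset f; have Eu : {subset E <= u} by move=> x /Eu1 /u1u.
exists E; split=> //; first by move=> x /Eu2 xu; rewrite mem_rcons inE xu orbT.
have bu : between E u u by split=> //; apply: nstop_nil.
have hu z : z \in rcons u2 (bary u) -> hull u z.
  by apply: sd_piece_hull; apply: sd_piece_cone p.
move=> y z yu zu; move: (yu) (zu); rewrite !mem_rcons !inE.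
move=> /orP[/eqP ->|yu2].
  by move=> _; right; exists u; split=> //; left; split=> //; apply: hu.
move=> /orP[/eqP ->|zu2].
  by right; exists u; split=> //; right; split=> //; apply: hu.
have [|[G [[EG Gu1 sG G0] H]]] := IH _ _ yu2 zu2; first by left.
right; exists G; split=> //; split=> //; first by move=> x /Gu1 /u1u.
by rewrite (leq_trans sG) // (facet_size f).
Qed.

Hypothesis OO_open : forall V, OO V -> open V.
Hypothesis OO_cover : forall x, exists2 V, OO V & V (val x).

(** An infinite sequence of non-stopped pieces; it will be shown not to exist. *)
Section Path.
Variables (f : nat -> seq pt).
Hypothesis f_piece : forall i, piece (f i) (f i.+1).
Hypothesis f_nstop : forall i, ~~ stop (f i).

Let K := size (f 0).

Lemma path_size i : size (f i) = K.
Proof. by elim: i => // i IH; rewrite (sd_piece_size (f_piece i)). Qed.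

Lemma path_hull i k : (i <= k)%N -> hull (f k) `<=` hull (f i).
Proof.
move=> /subnK <-; elim: (k - i)%N => // d IH.
apply: subset_trans IH; rewrite addSn; apply: hull_sub => x.
exact: sd_piece_hull (f_piece _).
Qed.

(* The face retained in the step from f i to f i.+1. *)
Let E i := projT1 (cid (sd_piece_struct (f_piece i))).

Lemma EP i : [/\ stop (E i), {subset E i <= f i}, {subset E i <= f i.+1} &
  forall y z, y \in f i.+1 -> z \in f i.+1 ->
    (y \in E i /\ z \in E i) \/ exists G, between (E i) G (f i) /\
      ((y = bary G /\ hull G z) \/ (z = bary G /\ hull G y))].
Proof. by rewrite /E; case: cid. Qed.

Definition kept i k x := forall j, (i <= j < k)%N -> x \in E j.
Definition persistent i x := forall j, (i <= j)%N -> x \in E j.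

Lemma keptS i k x : (i <= k)%N -> kept i k x -> x \in E k -> kept i k.+1 x.
Proof.
move=> ik xk xE j /andP[ij]; rewrite ltnS leq_eqVlt => /orP[/eqP ->//|jk].
by apply: xk; rewrite ij.
Qed.

(** Since f i is finite, there is a time k at which all its vertices that do not
    persist have been discarded. *)
Lemma not_kept i : exists2 k, (i <= k)%N & forall x, x \in f i ->
  kept i k x -> exists j, persistent j x.
Proof.
suff H u : exists2 k, (i <= k)%N & forall x, x \in u ->
    kept i k x -> exists j, persistent j x by exact: H.
elim: u => [|y u [k ik kP]]; first by exists i.
have [[j jP]|npy] := pselect (exists j, persistent j y).
  by exists k => // x; rewrite inE => /orP[/eqP ->|]; [exists j | apply: kP].
have [j ij yj] : exists2 j, (i <= j)%N & y \notin E j.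
  apply: contrapT => H; apply: npy; exists i => j ij.
  by apply: contrapT => /negP yj; apply: H; exists j.
exists (maxn k j.+1); first by rewrite (leq_trans ik) ?leq_maxl.
have kle x k1 k2 : (k1 <= k2)%N -> kept i k2 x -> kept i k1 x.
  by move=> k12 xk d /andP[id dk]; apply: xk; rewrite id (leq_trans dk).
move=> x; rewrite inE => /orP[/eqP -> yk|xu /(kle _ _ _ (leq_maxl _ _))].
  by have := yk j; rewrite ij leq_maxr (negbTE yj) => /(_ isT).
exact: kP.
Qed.

Let c : RR := 1 - K%:R^-1.

Lemma K_gt0 : (0 < K)%N.
Proof. by rewrite -(path_size 0) lt0n size_eq0; apply: nstop_nil. Qed.

Lemma c_ge0 : 0 <= c.
Proof.
rewrite subr_ge0 invf_le1 ?ltr0n ?K_gt0 //.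
by rewrite -[1]/(1%:R) ler_nat K_gt0.
Qed.

Lemma c_lt1 : c < 1.
Proof. by rewrite gtrBl invr_gt0 ltr0n K_gt0. Qed.

(** Iteration of a contraction step: quantities bounded by M in a sequence of
    stages become smaller than any e > 0. *)
Lemma contract_to0 (A : nat -> RR -> Prop) i0 M e : 0 <= M -> 0 < e ->
  A i0 M ->
  (forall i M, (i0 <= i)%N -> 0 <= M -> A i M ->
     exists2 k, (i <= k)%N & A k (c * M)) ->
  exists i M', [/\ (i0 <= i)%N, 0 <= M', M' <= e & A i M'].
Proof.
move=> M0 e0 AM H.
have HN N : exists2 i, (i0 <= i)%N & A i (c ^+ N * M).
  elim: N => [|N [i ii0 Ai]]; first by exists i0; rewrite // expr0 mul1r.
  have [|k ik Ak] := H i (c ^+ N * M) ii0 _ Ai.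
    by rewrite mulr_ge0 // exprn_ge0 // c_ge0.
  by exists k; [apply: leq_trans ik | rewrite exprS -mulrA].
have : (c ^+ N * M) @[N --> \oo] --> 0 * M.
  apply: cvgMl; apply: cvg_expr; rewrite ger0_norm ?c_ge0 ?c_lt1 //.
rewrite mul0r => /cvgr0Pnorm_le /(_ e e0) [N _ /(_ N (leqnn N))] /= cN.
have [i ii0 Ai] := HN N; exists i, (c ^+ N * M); split=> //.
  by rewrite mulr_ge0 // exprn_ge0 // c_ge0.
exact: le_trans (ler_norm _) cN.
Qed.

Lemma kept_f i k x : (i <= k)%N -> x \in f k -> kept i k x -> x \in f i.
Proof.
rewrite leq_eqVlt => /orP[/eqP <- //|ik] _ xk.
by have [_ sub _ _] := EP i; apply: sub; apply: xk; rewrite leqnn.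
Qed.

Lemma val_bary_norm (G : seq pt) (x : pt) M k : 0 <= M -> between (E k) G (f k) ->
  (forall y z, y \in f k -> z \in f k -> `|val y - val z| <= M) ->
  hull G x -> `|val (bary G) - val x| <= c * M.
Proof.
move=> M0 [_ Gf sG G0] dM Gx; rewrite distrC.
apply: (Gx [set z | `|z - val (bary G)| <= c * M]); first exact: convex_ball.
move=> y yG /=; rewrite distrC val_bary //.
have [] := @avg_near _ _ [set val y] M K G y _ M0 _ yG erefl.
- by move=> _ _ a _ _ -> ->; rewrite -scalerDl addrC subrK scale1r.
- by rewrite -(path_size k).
- by move=> z zG; exists (val y) => //; apply: dM; apply: Gf.
by move=> _ ->.
Qed.

(** If nothing persists, wait until every vertex of f i has been replaced: each
    pair of vertices then contains one that was created, as the barycentre of a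
    face whose hull contains the other, after time i. *)
Lemma diam_step i M : (forall x j, ~ persistent j x) -> 0 <= M ->
  (forall y z, y \in f i -> z \in f i -> `|val y - val z| <= M) ->
  exists2 k, (i <= k)%N &
    forall y z, y \in f k -> z \in f k -> `|val y - val z| <= c * M.
Proof.
move=> nper M0 dM.
have dMk k : (i <= k)%N ->
    forall y z, y \in f k -> z \in f k -> `|val y - val z| <= M.
  move=> ik y z /hull_mem/(path_hull ik) yk /hull_mem/(path_hull ik) zk.
  apply: (yk [set w | `|w - val z| <= M]); first exact: convex_ball.
  move=> y' y'i /=; rewrite distrC.
  apply: (zk [set w | `|w - val y'| <= M]); first exact: convex_ball.
  by move=> z' z'i /=; apply: dM.
have [k ik kP] := not_kept i; exists k => //.
suff H d y z : y \in f (d + i) -> z \in f (d + i) ->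
    (kept i (d + i) y /\ kept i (d + i) z) \/ `|val y - val z| <= c * M.
  move=> y z yk zk; have := H (k - i)%N y z; rewrite subnK // => -[] // [yi _].
  have [j] := kP y (kept_f ik yk yi) yi.
  by move=> /nper.
elim: d y z => [|d IH] y z yd zd; first by left; split=> j /andP[ij]; rewrite ltnNge ij.
have [_ Ef _ /(_ _ _ yd zd) [[yE zE]|[G [bG]]]] := EP (d + i).
  have [[yk zk]|] := IH _ _ (Ef _ yE) (Ef _ zE); last by right.
  by left; split; apply: keptS => //; apply: leq_addl.
move=> [] [-> hG]; right; last rewrite distrC.
  exact: val_bary_norm bG (dMk _ (leq_addl _ _)) hG.
exact: val_bary_norm bG (dMk _ (leq_addl _ _)) hG.
Qed.

Lemma path_f_neq0 i : exists x, x \in f i.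
Proof.
by have := nstop_nil (f_nstop i); case: (f i) => // x u _; exists x; apply: mem_head.
Qed.

Lemma norm_pt x y : `|val x - val y| <= 2.
Proof.
rewrite (le_trans (ler_normB _ _)) //.
by rewrite (_ : 2 = 1 + 1) // lerD // norm_stdsimplex //; apply: pointP.
Qed.

Lemma no_persistent : (forall x j, ~ persistent j x) -> False.
Proof.
move=> nper.
have [x|e e0 eP] := lebesgue_number (@compact_stdsimplex RR m) OO_open.
  by move=> sx; have [V OV Vx] := OO_cover (to_point sx); exists V.
(* Points of the standard simplex have norm at most 1: start from the bound 2. *)
have [||||i [M [_ M0 Me dM]]] := @contract_to0
  (fun i M => forall y z, y \in f i -> z \in f i -> `|val y - val z| <= M) 0%N 2 e.
- by [].
- by [].
- by move=> *; apply: norm_pt.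
- by move=> i M _ M0; apply: diam_step.
have [x xi] := path_f_neq0 i; have [V OV VP] := eP _ (pointP x).
have /negP := f_nstop i; apply; apply/orP; right; apply/asboolP; exists V => // y yi.
apply: VP; apply: le_trans Me.
apply: (yi [set w | `|w - val x| <= M]); first exact: convex_ball.
by move=> z zi /=; apply: dM.
Qed.

(** A finite set of persistent vertices is contained in a single retained face,
    so it has at most K elements; take a maximal one. *)
Lemma persistent_finite x0 j0 : persistent j0 x0 -> exists i0 S,
  [/\ S != [::], forall x, x \in S -> persistent i0 x &
      forall x j, persistent j x -> x \in S].
Proof.
move=> p0; pose ok S := uniq S /\ forall x, x \in S -> exists j, persistent j x.
have common S : (forall x, x \in S -> exists j, persistent j x) ->
    exists i0, forall x, x \in S -> persistent i0 x.
  elim: S => [|x S IH] H; first by exists 0%N.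
  have [i1 i1P] : exists i0, forall x, x \in S -> persistent i0 x.
    by apply: IH => y yS; apply: H; rewrite inE yS orbT.
  have [i2 i2P] := H x (mem_head _ _); exists (maxn i1 i2) => y.
  rewrite inE => /orP[/eqP ->|/i1P yP] j ij; [apply: i2P|apply: yP].
    by apply: leq_trans ij; apply: leq_maxr.
  by apply: leq_trans ij; apply: leq_maxl.
pose q n := `[< exists2 S, ok S & size S = n >].
have q1 : exists n, q n.
  by exists 0%N; apply/asboolP; exists [::].
have qK n : q n -> (n <= K)%N.
  move=> /asboolP[S [uS /common [i0 i0P]] <-].
  rewrite -(path_size i0); apply: uniq_leq_size => // x /i0P /(_ _ (leqnn _)).
  by have [_ sub _ _] := EP i0; apply: sub.
have [n /asboolP[S [uS SP] sS] nmax] := ex_maxnP q1 qK.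
have Sall x j : persistent j x -> x \in S.
  move=> px; apply/negPn/negP => xS; suff : (n.+1 <= n)%N by rewrite ltnn.
  apply: nmax; apply/asboolP; exists (x :: S); last by rewrite /= sS.
  split=> /=; first by rewrite xS.
  by move=> y; rewrite inE => /orP[/eqP ->|/SP //]; exists j.
have [i0 i0P] := common _ SP; exists i0, S; split=> //.
by have := Sall _ _ p0; case: (S).
Qed.

(** If S is the set of persistent vertices, every barycentre created after time
    i0 is that of a face containing S, so it is closer to the hull of S by the
    factor 1 - 1/K than the farthest vertex was. *)
Lemma near_step i0 (S : seq pt) i M : S != [::] ->
  (forall x, x \in S -> persistent i0 x) ->
  (forall x j, persistent j x -> x \in S) -> (i0 <= i)%N -> 0 <= M ->
  (forall x, x \in f i -> near_set (val @` hull S) M (val x)) ->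
  exists2 k, (i <= k)%N &
    forall x, x \in f k -> near_set (val @` hull S) (c * M) (val x).
Proof.
move=> S0 Sp Sall i0i M0 nM.
have nMk k : (i <= k)%N ->
    forall x, x \in f k -> near_set (val @` hull S) M (val x).
  move=> ik x /hull_mem/(path_hull ik); apply => //.
  by apply: convex_near_set; apply: convex_hull.
have Snear x : x \in S -> (val @` hull S) (val x).
  by move=> xS; exists x => //; apply: hull_mem.
have [k ik kP] := not_kept i; exists k => //.
suff H d x : x \in f (d + i) ->
    kept i (d + i) x \/ near_set (val @` hull S) (c * M) (val x).
  move=> x xk; have := H (k - i)%N x; rewrite subnK // => -[] // xi.
  have [j /Sall xS] := kP x (kept_f ik xk xi) xi.
  by exists (val x); [apply: Snear|rewrite subrr normr0 mulr_ge0 // c_ge0].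
elim: d x => [|d IH] x xd; first by left=> j /andP[ij]; rewrite ltnNge ij.
have [_ Ef _ /(_ _ _ xd xd) [[xE _]|[G [bG xG]]]] := EP (d + i).
  have [xk|] := IH _ (Ef _ xE); last by right.
  by left; apply: keptS => //; apply: leq_addl.
have {xG} -> : x = bary G by case: xG => -[].
have [EG Gf sG G0] := bG; right; rewrite val_bary //.
have [x0 x0S] : exists x0, x0 \in S.
  by case: (S) S0 => // y u _; exists y; apply: mem_head.
apply: (@avg_near _ _ _ _ _ _ x0) => //.
- exact: convex_hull.
- by rewrite -(path_size (d + i)).
- by apply: EG; apply: Sp => //; apply: leq_trans i0i _; apply: leq_addl.
- exact: Snear.
by move=> y /Gf; apply: nMk; apply: leq_addl.
Qed.

Lemma path_false : False.
Proof.
have [[x1 [j0 /persistent_finite [i0 [S [S0 Sp Sall]]]]]|nper] :=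
    pselect (exists x j, persistent j x); last first.
  by apply: no_persistent => x j xj; apply: nper; exists x, j.
have [x0 x0S] : exists x0, x0 \in S.
  by case: (S) S0 => // y u _; exists y; apply: mem_head.
have SE : {subset S <= E i0} by move=> x /Sp; apply.
have [sE _ _ _] := EP i0; have := stop_subset SE sE.
rewrite /stop (negbTE S0) /= => /asboolP[V OV SV].
have cS : compact (val @` hull S).
  have -> : S = mkseq (nth x0 S) (size S).-1.+1.
    by rewrite prednK ?lt0n ?size_eq0 // mkseq_nth.
  exact: compact_hull.
have [_ ->|_ [x Sx <-]|e e0 eP] := @lebesgue_number _ _ _ [set V] cS.
- exact: OO_open.
- by exists V => //; apply: SV.
have [||||i [M [_ M0 Me nM]]] := @contract_to0
  (fun i M => forall x, x \in f i -> near_set (val @` hull S) M (val x)) i0 2 e.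
- by [].
- by [].
- move=> x _; exists (val x0); last exact: norm_pt.
  by exists x0 => //; apply: hull_mem.
- by move=> i M ii0 M0; apply: near_step ii0 M0.
have /negP := f_nstop i; apply; apply/orP; right; apply/asboolP; exists V => // y yi.
have [|p Sp' yp] := yi (near_set (val @` hull S) M) _ nM.
  by apply: convex_near_set; apply: convex_hull.
by have [_ -> ] := eP _ Sp'; apply; apply: le_trans Me.
Qed.

End Path.

(** Koenig's lemma: a simplex with no depth has a piece with no depth. *)
Lemma stable_ex l : exists N, stable stop (@bary RR m) N l.
Proof.
apply: contrapT => nst.
pose bad u := ~ exists N, stable stop (@bary RR m) N u.
have /choice [g gP] : forall u, exists u', bad u -> piece u u' /\ bad u'.
  move=> u; have [bu|] := pselect (bad u); last by exists u.
  apply: contrapT => H; apply: bu; apply: stable_branch => u' uu'.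
  by apply: contrapT => bu'; apply: H; exists u'.
pose f i := iter i g l.
have fb i : bad (f i) by elim: i => // i /gP [].
apply: (@path_false f) => i; first by have [] := gP _ (fb i).
by apply/negP => sf; apply: (fb i); exists 0%N.
Qed.

End Termination.

(** * Affine simplices inside a filtered simplex *)

Section Label.
Variable X : filtered_space.

Lemma in_skeleton (y : X) : exists i, `[< skeleton X i y >].
Proof. by exists (fdim X); apply/asboolP; rewrite skeleton_top. Qed.

(** The label of a vertex of a filtered simplex is the level of its image, which
    makes labels natural for affine maps between simplices. *)
Definition level (y : X) : nat := ex_minn (in_skeleton y).

Lemma levelP y i : skeleton X i y <-> (level y <= i)%N.
Proof.
rewrite /level; case: ex_minnP => j /asboolP yj jmin; split=> [yi|ji].
  by apply: jmin; apply/asboolP.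
exact: skeleton_le ji _ yj.
Qed.

Lemma level_le y : (level y <= fdim X)%N.
Proof. by apply/levelP; rewrite skeleton_top. Qed.

End Label.

Section Simplex.
Variables (RR : realType) (X : filtered_space) (m : nat) (s : fsimplex RR X m).
Local Notation pt := (stdsimplex RR m).
Implicit Types (x y : pt) (l : seq pt).

Definition point_level x : nat := level (s x).

Lemma point_level_leP i x :
  (point_level x <= i)%N <-> (forall v, (i < lab s v)%N -> val x ord0 v = 0).
Proof.
have [ni|ni] := ltnP (fdim X) i.
  split=> [_ v iv|_]; last by rewrite (leq_trans (level_le _)) // ltnW.
  by have := leq_trans ni (ltnW iv); rewrite leqNgt ltn_ord.
rewrite /point_level; split=> [/levelP|h].
  by rewrite -[i]/(val (Ordinal (ni : (i < (fdim X).+1)%N))) => /fsimplex_filtered.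
by apply/levelP; apply/(fsimplex_filtered s (Ordinal (ni : (i < (fdim X).+1)%N))).
Qed.

Lemma lab_vertex v : lab s v = point_level (vertex RR v) :> nat.
Proof.
apply/eqP; rewrite eqn_leq; apply/andP; split.
  rewrite leqNgt; apply/negP => lt.
  have /point_level_leP/(_ v lt)/eqP := leqnn (point_level (vertex RR v)).
  by rewrite /= mxE !eqxx oner_eq0.
apply/point_level_leP => w vw; rewrite /= mxE eqxx /=.
by case: eqP => // e; rewrite e ltnn in vw.
Qed.

(** At an interior point of a segment a barycentric coordinate vanishes iff it
    vanishes at both ends, so the level is the maximum of those of the ends. *)
Lemma point_level_hull l x : hull l x -> exists2 y, y \in l & point_level x = point_level y.
Proof.
(* The points whose level is a level of l form a convex set containing l. *)
pose C := [set z : 'rV[RR]_m.+1 |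
  exists2 x, val x = z & exists2 y, y \in l & point_level x = point_level y].
have cC : convex C.
  move=> _ _ a a0 a1 [x1 <- [y1 yl1 e1]] [x2 <- [y2 yl2 e2]].
  have [->|an0] := eqVneq a 0.
    by exists x2; [rewrite scale0r add0r subr0 scale1r|exists y2].
  have [->|an1] := eqVneq a 1.
    by exists x1; [rewrite subrr scale0r addr0 scale1r|exists y1].
  have a_gt0 : 0 < a by rewrite lt_neqAle eq_sym an0.
  have a'_gt0 : 0 < 1 - a by rewrite subr_gt0 lt_neqAle an1.
  pose z := to_point (convex_stdsimplex a0 a1 (pointP x1) (pointP x2)).
  exists z => //.
  have zmax i : (point_level z <= i)%N =
      (point_level x1 <= i)%N && (point_level x2 <= i)%N.
    apply/idP/andP => [/point_level_leP h|[/point_level_leP h1 /point_level_leP h2]].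
      have {}h v : (i < lab s v)%N -> (val x1 ord0 v == 0) && (val x2 ord0 v == 0).
        have [x1n _] := pointP x1; have [x2n _] := pointP x2.
        move=> /h /eqP; rewrite !mxE paddr_eq0 ?mulr_ge0 // ?(ltW a'_gt0) //.
        by rewrite !mulf_eq0 (gt_eqF a_gt0) (gt_eqF a'_gt0).
      by split; apply/point_level_leP => v /h /andP[/eqP ? /eqP].
    apply/point_level_leP => v iv.
    by rewrite !mxE h1 // h2 // !mulr0 addr0.
  have ez : point_level z = maxn (point_level x1) (point_level x2).
    apply/eqP; rewrite eqn_leq zmax leq_maxl leq_maxr geq_max /=.
    by rewrite -zmax leqnn.
  rewrite ez; case: (leqP (point_level x1) (point_level x2)) => _; first by exists y2.
  by exists y1.
move=> /(_ C cC) [|x' /val_inj -> //].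
by move=> y yl; exists y => //; exists y.
Qed.

(** All coordinates that are non-zero at some vertex of l are non-zero at its
    barycentre. *)
Lemma point_level_bary l y : y \in l -> (point_level y <= point_level (bary l))%N.
Proof.
move=> yl; apply/point_level_leP => v lv.
have l0 : l != [::] by case: l yl {lv}.
have /point_level_leP/(_ v lv)/eqP := leqnn (point_level (bary l)).
rewrite val_bary // /avg summxE psumr_eq0 => [/allP/(_ y yl)|x _].
  rewrite mxE mulf_eq0 invr_eq0 pnatr_eq0 size_eq0 (negbTE l0) /=.
  by move/eqP.
by rewrite mxE mulr_ge0 ?invr_ge0 ?ler0n //; have [] := pointP x.
Qed.

End Simplex.

(** The map determines the labels, by [lab_vertex]. *)
Lemma fsimplex_eq (RR : realType) (X : filtered_space) m (s s' : fsimplex RR X m) :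
  (forall t, s t = s' t) -> s = s'.
Proof.
move=> e; have el : lab s = lab s'.
  by apply/ffunP => v; apply: val_inj; rewrite /= !lab_vertex /point_level e.
case: s s' e el => [la f h c g] [la' f' h' c' g'] /= e el.
have ef : f = f' by apply/funext.
by subst; congr FilteredSimplex; apply: Prop_irrelevance.
Qed.

Section Sub.
Variables (RR : realType) (X : filtered_space) (m : nat) (s : fsimplex RR X m).
Variables (k : nat) (p : nat -> stdsimplex RR m).

(** The condition for the composite of s with the affine simplex p 0, ..., p k
    to be a filtered simplex for the given order of its vertices. *)
Definition level_nondec : Prop :=
  forall i j, (i <= j)%N -> (j <= k)%N -> (point_level s (p i) <= point_level s (p j))%N.

Hypothesis h : level_nondec.

Definition subsimplex_lab : {ffun 'I_k.+1 -> 'I_(fdim X).+1} :=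
  [ffun v : 'I_k.+1 => inord (point_level s (p v))].

Lemma subsimplex_labE v : subsimplex_lab v = point_level s (p v) :> nat.
Proof. by rewrite ffunE inordK // ltnS level_le. Qed.

Lemma subsimplex_lab_homo : {homo subsimplex_lab : v w / (v <= w)%N}.
Proof.
by move=> v w vw; rewrite !subsimplex_labE; apply: h => //; rewrite -ltnS.
Qed.

Lemma subsimplex_continuous : continuous (s \o @comb RR m k p).
Proof.
move=> t; apply: continuous_comp; first exact: comb_continuous.
exact: fsimplex_continuous.
Qed.

Lemma subsimplex_filtered (i : 'I_(fdim X).+1) t :
  skeleton X i ((s \o @comb RR m k p) t) <->
  (forall v, (i < subsimplex_lab v)%N -> set_val t ord0 v = 0).
Proof.
have [t0 t1] := pointP t.
rewrite levelP -[level _]/(point_level s (comb p t)) point_level_leP; split=> [H v iv|H w iw].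
  apply/eqP; apply: contraLR iv => tv; rewrite -leqNgt subsimplex_labE.
  apply/point_level_leP => w /H /eqP; rewrite val_comb mxE psumr_eq0 => [|u _].
    move/allP/(_ v (mem_index_enum _)); rewrite mulf_eq0 (negbTE tv) mxE /=.
    by move/eqP.
  by rewrite mxE mulr_ge0 //; have [] := pointP (p u).
rewrite val_comb mxE big1 // => v _; have [iv|iv] := ltnP i (subsimplex_lab v).
  by rewrite [val t _ _]H // mul0r.
rewrite subsimplex_labE in iv; move/point_level_leP: iv => /(_ w iw) pvw.
by rewrite mxE pvw mulr0.
Qed.

Definition subsimplex : fsimplex RR X k :=
  FilteredSimplex subsimplex_lab_homo subsimplex_continuous subsimplex_filtered.

End Sub.

Section CombAlgebra.
Variable RR : realType.

Lemma comb_comb m k k' (p : nat -> stdsimplex RR m) (q : nat -> stdsimplex RR k)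
    (t : stdsimplex RR k') :
  comb p (comb q t) = comb (comb p \o q) t.
Proof.
apply: val_inj; rewrite !val_comb -mulmxA; congr (_ *m _).
by apply/row_matrixP => i; rewrite row_mul !row_points_mx /= -val_comb.
Qed.

Lemma comb_ext m k (p q : nat -> stdsimplex RR m) :
  (forall i, (i <= k)%N -> p i = q i) ->
  forall t : stdsimplex RR k, comb p t = comb q t.
Proof.
move=> pq t; apply: val_inj; rewrite !val_comb; congr (_ *m _).
by apply/row_matrixP => i; rewrite !row_points_mx pq // -ltnS.
Qed.

Lemma comb_id m (t : stdsimplex RR m) :
  comb (fun i => vertex RR (inord i)) t = t.
Proof.
apply: val_inj; rewrite val_comb -[RHS]mulmx1; congr (_ *m _).
by apply/row_matrixP => i; rewrite row_points_mx /= inord_val row1.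
Qed.

End CombAlgebra.

Section Evaluation.
Variables (RR : realType) (R : comPzRingType) (X : filtered_space).

Definition simplex_fun := forall m, fsimplex RR X m -> R.
Implicit Types (G : simplex_fun).

(** The value of G on the affine simplex with the given vertices, and 0 if these
    do not form a filtered simplex.  The points are indexed by nat so that the
    dimension is an explicit argument and no casts between dimensions occur. *)
Definition ev_points G m (s : fsimplex RR X m) k p : R :=
  if pselect (level_nondec s k p) is left h then G k (subsimplex h) else 0.

Definition ev G m (s : fsimplex RR X m) (l : seq (stdsimplex RR m)) : R :=
  if l is x :: l' then ev_points G s (size l') (nth x l) else 0.

Lemma ev_pointsE G m (s : fsimplex RR X m) k p (h : level_nondec s k p) :
  ev_points G s k p = G k (subsimplex h).
Proof.
rewrite /ev_points; case: pselect => // h'.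
by congr (G _ _); apply: fsimplex_eq.
Qed.

Lemma ev_points_ext G m (s : fsimplex RR X m) k p q :
  (forall i, (i <= k)%N -> p i = q i) -> ev_points G s k p = ev_points G s k q.
Proof.
move=> pq; have e : level_nondec s k p <-> level_nondec s k q.
  split=> h i j ij jk; have ik := leq_trans ij jk.
    by rewrite -!pq //; apply: h.
  by rewrite !pq //; apply: h.
have [h|nh] := pselect (level_nondec s k p).
  have h' := e.1 h; rewrite !ev_pointsE; congr (G _ _); apply: fsimplex_eq => t /=.
  by rewrite (comb_ext pq).
by rewrite /ev_points; case: pselect => // _; case: pselect => // /[dup] /e.
Qed.

Lemma ev_mkseq G m (s : fsimplex RR X m) k p :
  ev G s (mkseq p k.+1) = ev_points G s k p.
Proof.
rewrite /= size_map size_iota; apply: ev_points_ext => i ik.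
exact: (@nth_mkseq _ (p 0%N) p k.+1 i ik).
Qed.

(** An affine simplex of an affine simplex is an affine simplex: this naturality
    lets all computations take place inside one fixed simplex s. *)
Lemma ev_subsimplex G m (s : fsimplex RR X m) k p (h : level_nondec s k p)
    (l : seq (stdsimplex RR k)) :
  ev G (subsimplex h) l = ev G s (map (comb p) l).
Proof.
case: l => // x l; rewrite [RHS]/= size_map.
rewrite (@ev_points_ext _ _ _ _ _ (comb p \o nth x (x :: l))); last first.
  by move=> i il; rewrite -[_ :: map _ _]/(map _ (x :: l)) (nth_map x).
rewrite /ev; set q := nth x _.
have [h'|nh] := pselect (level_nondec (subsimplex h) (size l) q).
  have h'' : level_nondec s (size l) (comb p \o q) := h'.
  rewrite !ev_pointsE; congr (G _ _); apply: fsimplex_eq => t /=.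
  by rewrite comb_comb.
by rewrite /ev_points; case: pselect => // _; case: pselect.
Qed.

Definition verts m : seq (stdsimplex RR m) := map (@vertex RR m) (enum 'I_m.+1).

Lemma verts_mkseq m : verts m = mkseq (fun i => vertex RR (inord i)) m.+1.
Proof.
rewrite /verts /mkseq -val_enum_ord -map_comp; apply: eq_map => i /=.
by rewrite inord_val.
Qed.

Lemma level_nondec_verts m (s : fsimplex RR X m) :
  level_nondec s m (fun i => vertex RR (inord i)).
Proof.
move=> i j ij jm; rewrite -!lab_vertex; apply: lab_homo.
by rewrite !inordK // ltnS // (leq_trans ij).
Qed.

Lemma ev_verts G m (s : fsimplex RR X m) : ev G s (verts m) = G m s.
Proof.
rewrite verts_mkseq ev_mkseq (ev_pointsE _ (@level_nondec_verts _ s)).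
by congr (G _ _); apply: fsimplex_eq => t /=; rewrite comb_id.
Qed.

Lemma map_comb_verts m k (p : nat -> stdsimplex RR m) :
  map (comb p) (verts k) = mkseq p k.+1.
Proof.
rewrite /verts /mkseq -val_enum_ord -!map_comp; apply: eq_map => i /=.
by rewrite comb_vertex.
Qed.

Definition admissible m (s : fsimplex RR X m) l : bool :=
  (l != [::]) && sorted leq (map (point_level s) l).

Lemma admissibleP m (s : fsimplex RR X m) l : admissible s l ->
  exists k p, l = mkseq p k.+1 /\ level_nondec s k p.
Proof.
case: l => // x l /andP[_ srt]; exists (size l), (nth x (x :: l)).
split; first exact: (esym (mkseq_nth x (x :: l))).
move=> i j ij jl.
have := sorted_leq_nth leq_trans leqnn 0%N srt i j.
rewrite !inE size_map /= !ltnS jl (leq_trans ij jl) => /(_ isT isT ij).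
by rewrite -[_ :: map _ _]/(map _ (x :: l)) !(nth_map x) //= ltnS // (leq_trans ij).
Qed.

Lemma mkseq_admissible m (s : fsimplex RR X m) k p :
  level_nondec s k p -> admissible s (mkseq p k.+1).
Proof.
move=> h; rewrite /admissible -size_eq0 size_mkseq andTb -map_comp.
apply/(sortedP 0%N) => i; rewrite size_map size_iota => ik.
rewrite !(nth_map 0%N) ?size_iota ?(ltnW ik) // !nth_iota ?(ltnW ik) //=.
by apply: h.
Qed.

Lemma ev_not_admissible G m (s : fsimplex RR X m) l : ~~ admissible s l -> ev G s l = 0.
Proof.
case: l => // x l nadm; rewrite /= /ev_points; case: pselect => // h.
have := mkseq_admissible h.
by rewrite -[(size l).+1]/(size (x :: l)) mkseq_nth (negbTE nadm).
Qed.

End Evaluation.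

(** * Pieces of a subdivision keep labels and count vertices by label *)

Lemma facet_subseq (T : eqType) (l1 l : seq T) : facet l1 l -> subseq l1 l.
Proof. by elim=> [x u|x u1 u _ IH]; [apply: subseq_cons | rewrite /= eqxx]. Qed.

Lemma facet_count (T : eqType) (P : pred T) (l1 l : seq T) : facet l1 l ->
  exists2 v, v \in l & count P l = (count P l1 + P v)%N.
Proof.
elim=> [x u|x u1 u _ [v vu IH]]; first by exists x; rewrite ?mem_head //= addnC.
by exists v; rewrite ?inE ?vu ?orbT //= IH addnA.
Qed.

Section Refinement.
Variables (RR : realType) (X : filtered_space) (m : nat) (s : fsimplex RR X m).
Variable st : pred (seq (stdsimplex RR m)).
Hypothesis st_nil : st [::].
Local Notation pt := (stdsimplex RR m).
Implicit Types (x y : pt) (l : seq pt).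

Definition count_above j l : nat := count (fun x => j < point_level s x)%N l.

(** What is needed to know of a piece l' of l: it is a filtered simplex inside l,
    thus with no new label, and for every j it has at least as many vertices of
    label > j.  The last condition makes the operators respect perversities. *)
Definition refines l l' : Prop :=
  [/\ admissible s l', forall x, x \in l' -> hull l x &
      forall j, (count_above j l <= count_above j l')%N].

Lemma refines_refl l : admissible s l -> refines l l.
Proof. by move=> al; split=> // x; apply: hull_mem. Qed.

Lemma refines_trans l l1 l2 : refines l l1 -> refines l1 l2 -> refines l l2.
Proof.
move=> [_ h1 c1] [a2 h2 c2]; split=> // [x /h2|j]; last exact: leq_trans (c2 j).
exact: hull_sub.
Qed.

Let srt l := sorted leq (map (point_level s) l).

Lemma sorted_facet l1 l : facet l1 l -> srt l -> srt l1.
Proof.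
move=> /facet_subseq f; apply: subseq_sorted; first exact: leq_trans.
exact: map_subseq.
Qed.

Lemma sorted_rcons_bary l l2 : (forall x, x \in l2 -> hull l x) -> srt l2 ->
  srt (rcons l2 (bary l)).
Proof.
move=> hl; rewrite /srt map_rcons !sorted_pairwise; try exact: leq_trans.
rewrite pairwise_rcons => ->; rewrite andbT.
apply/allP => _ /mapP[x /hl /(point_level_hull s) [y yl ->] ->].
exact: point_level_bary.
Qed.

(** The vertex omitted in the facet is compensated by the cone point, whose
    label is maximal. *)
Lemma count_above_cone j l l1 l2 : facet l1 l -> (count_above j l1 <= count_above j l2)%N ->
  (count_above j l <= count_above j (rcons l2 (bary l)))%N.
Proof.
move=> f c; have [v vl e] := facet_count (fun x => j < point_level s x)%N f.
rewrite /count_above e -cats1 count_cat /= addn0; apply: leq_add => //.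
case: (boolP (j < point_level s v)%N) => // jv.
by rewrite (leq_trans jv (point_level_bary s vl)).
Qed.

Let good l l' := [/\ srt l', forall x, x \in l' -> hull l x &
  forall j, (count_above j l <= count_above j l')%N].

Lemma good_cone u u1 u2 : u != [::] -> facet u1 u -> good u1 u2 ->
  good u (rcons u2 (bary u)).
Proof.
move=> u0 f [su2 hu2 cu2].
have hu x : x \in u2 -> hull u x.
  by move=> /hu2; apply: hull_sub => y /(facet_subset f); apply: hull_mem.
split; first exact: sorted_rcons_bary.
  move=> x; rewrite mem_rcons inE => /orP[/eqP ->|/hu //].
  exact: hull_bary.
by move=> j; apply: (count_above_cone f).
Qed.

Lemma sd_piece_good l l' : sd_piece st (@bary RR m) l l' -> srt l -> good l l'.
Proof.
elim=> [u _ su|u u1 u2 nu f _ IH su]; first by split=> // x; apply: hull_mem.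
have u0 : u != [::] by apply: contra nu => /eqP ->.
by apply: (good_cone u0 f); apply: IH; apply: sorted_facet f su.
Qed.

Lemma htp_piece_good l l' : htp_piece st (@bary RR m) l l' -> srt l -> good l l'.
Proof.
elim=> [u nu su|u u1 u2 nu f _ IH su];
  have u0 : u != [::] by apply: contra nu => /eqP ->.
  split; first by apply: sorted_rcons_bary => // x; apply: hull_mem.
    move=> x; rewrite mem_rcons inE => /orP[/eqP ->|]; last exact: hull_mem.
    exact: hull_bary.
  by move=> j; rewrite /count_above -cats1 count_cat leq_addr.
by apply: (good_cone u0 f); apply: IH; apply: sorted_facet f su.
Qed.

Lemma sd_piece_refines l l' :
  sd_piece st (@bary RR m) l l' -> admissible s l -> refines l l'.
Proof.
move=> p /andP[l0 sl]; have [sl' hl' cl'] := sd_piece_good p sl; split=> //.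
by apply/andP; split=> //; rewrite -size_eq0 (sd_piece_size p) size_eq0.
Qed.

Lemma htp_piece_refines l l' :
  htp_piece st (@bary RR m) l l' -> admissible s l -> refines l l'.
Proof.
move=> p /andP[l0 sl]; have [sl' hl' cl'] := htp_piece_good p sl; split=> //.
by apply/andP; split=> //; rewrite -size_eq0 (htp_piece_size p).
Qed.

End Refinement.

(** * The operators for an open cover of a filtered space *)

Section Cover.
Variables (RR : realType) (R : comPzRingType) (X : filtered_space).
Variable U : set (set X).
Hypothesis coverU : is_open_cover U.

Section OneSimplex.
Variables (m : nat) (s : fsimplex RR X m).
Local Notation pt := (stdsimplex RR m).
Implicit Types (x y : pt) (l : seq pt) (F : seq pt -> R).

(** The cover of the simplex by the preimages of the members of U, as open
    subsets of the ambient vector space. *)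
Definition pulled_cover : set (set 'rV[RR]_m.+1) :=
  [set V | open V /\ exists2 W, U W & forall x : pt, V (val x) <-> W (s x)].

Lemma pulled_open W : U W ->
  exists2 V, pulled_cover V & forall x : pt, V (val x) <-> W (s x).
Proof.
move=> UW; have : open (s @^-1` W).
  apply: open_comp; last exact: (coverU.1 _ UW).
  by move=> t _; apply: fsimplex_continuous.
move=> [V oV VW].
have VWx (x : pt) : V (val x) <-> W (s x).
  by rewrite -[V _]/((set_val @^-1` V) x) VW.
by exists V => //; split=> //; exists W.
Qed.

Lemma pulled_cover_open V : pulled_cover V -> open V.
Proof. by case. Qed.

Lemma pulled_coverP x : exists2 V, pulled_cover V & V (val x).
Proof.
have : (\bigcup_(W in U) W) (s x) by rewrite coverU.2.
move=> [W UW Wx]; have [V VP VW] := pulled_open UW.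
by exists V => //; apply/VW.
Qed.

Definition stop_at : pred (seq pt) := stop pulled_cover.

Lemma stop_atP l :
  stop_at l <-> l = [::] \/ exists2 W, U W & forall x, hull l x -> W (s x).
Proof.
split=> [/orP[/eqP|/asboolP[V [_ [W UW VW]] lV]]|[->//|[W UW lW]]].
- by left.
- by right; exists W => // x /lV /VW.
have [V VP VW] := pulled_open UW; apply/orP; right; apply/asboolP.
by exists V => // x /lW /VW.
Qed.

Definition sd_at F l : R :=
  fine_sd (stable_ex pulled_cover_open pulled_coverP) F l.
Definition htp_at F l : R :=
  fine_htp (stable_ex pulled_cover_open pulled_coverP) F l.

Lemma sd_at_lin a F F' l : sd_at (fun u => a * F u + F' u) l = a * sd_at F l + sd_at F' l.
Proof. by apply: sd_iter_lin; apply: stop_nil. Qed.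

Lemma htp_at_lin a F F' l : htp_at (fun u => a * F u + F' u) l = a * htp_at F l + htp_at F' l.
Proof. by apply: htp_iter_lin; apply: stop_nil. Qed.

Lemma sd_at_stop F l : stop_at l -> sd_at F l = F l.
Proof. by apply: fine_sd_stop; apply: stop_nil. Qed.

Lemma htp_at_stop F l : stop_at l -> htp_at F l = 0.
Proof. by move=> sl; rewrite /htp_at (@fine_htpE _ _ _ _ _ _ 0). Qed.

Lemma sd_at_bd F l : sd_at (bd F) l = bd (sd_at F) l.
Proof. by apply: fine_sd_bd; [apply: stop_nil|apply: stop_facet]. Qed.

Lemma htp_at_homotopy F l : htp_at (bd F) l + bd (htp_at F) l = F l - sd_at F l.
Proof. by apply: fine_homotopy; [apply: stop_nil|apply: stop_facet]. Qed.

Lemma sd_at_eq0 F l : admissible s l ->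
  (forall l', refines s l l' -> size l' = size l -> stop_at l' -> F l' = 0) ->
  sd_at F l = 0.
Proof.
move=> al F0.
apply: (@sd_iter_eq0 _ _ _ _ _ (fun l' => refines s l l' /\ size l' = size l)).
- exact: stop_nil.
- move=> l1 l2 [r1 s1] p; split; last by rewrite (sd_piece_size p).
  by apply: refines_trans (r1) _; apply: sd_piece_refines p _; case: r1.
- by move=> l' []; apply: F0.
- by split=> //; apply: refines_refl.
exact: depthP.
Qed.

Lemma htp_at_eq0 F l : admissible s l ->
  (forall l', refines s l l' -> size l' = (size l).+1 -> F l' = 0) ->
  htp_at F l = 0.
Proof.
move=> al F0.
apply: (@htp_iter_eq0 _ _ _ _ _ (fun l' => refines s l l' /\ size l' = size l)).
- exact: stop_nil.
- move=> l1 l2 [r1 s1] p; split; last by rewrite (sd_piece_size p).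
  by apply: refines_trans (r1) _; apply: sd_piece_refines p _; case: r1.
- move=> l1 l2 [r1 s1] p; apply: F0; last by rewrite (htp_piece_size p) s1.
  by apply: refines_trans (r1) _; apply: htp_piece_refines p _; case: r1.
by split=> //; apply: refines_refl.
Qed.

Lemma sd_at_ext F F' l : admissible s l ->
  (forall l', refines s l l' -> size l' = size l -> stop_at l' -> F l' = F' l') ->
  sd_at F l = sd_at F' l.
Proof.
move=> al FF'; apply/eqP; rewrite -subr_eq0 addrC -mulN1r -sd_at_lin.
by apply/eqP; apply: sd_at_eq0 => // l' r' s' t'; rewrite FF' // mulN1r addNr.
Qed.

Lemma htp_at_ext F F' l : admissible s l ->
  (forall l', refines s l l' -> size l' = (size l).+1 -> F l' = F' l') ->
  htp_at F l = htp_at F' l.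
Proof.
move=> al FF'; apply/eqP; rewrite -subr_eq0 addrC -mulN1r -htp_at_lin.
by apply/eqP; apply: htp_at_eq0 => // l' r' s'; rewrite FF' // mulN1r addNr.
Qed.

Lemma admissible_verts : admissible s (verts RR m).
Proof. by rewrite verts_mkseq; apply: mkseq_admissible; apply: level_nondec_verts. Qed.

Lemma size_verts : size (verts RR m) = m.+1.
Proof. by rewrite verts_mkseq size_mkseq. Qed.

End OneSimplex.

Section Naturality.
Variables (m : nat) (s : fsimplex RR X m) (k : nat) (p : nat -> stdsimplex RR m).
Hypothesis h : level_nondec s k p.

Lemma stop_at_subsimplex l : stop_at s (map (comb p) l) = stop_at (subsimplex h) l.
Proof.
apply/idP/idP => /stop_atP H; apply/stop_atP; case: H => [H|[W UW HW]].
- by left; case: l H.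
- right; exists W => // x lx; rewrite /=; apply: HW.
  by apply/hull_mapP; exists x.
- by left; rewrite H.
by right; exists W => // _ /hull_mapP[x lx ->]; apply: HW.
Qed.

Lemma bary_subsimplex l : ~~ stop_at (subsimplex h) l ->
  bary (map (comb p) l) = comb p (bary l).
Proof. by move=> sl; apply: bary_comb; apply: contra sl => /eqP ->. Qed.

Lemma sd_at_subsimplex (F : seq (stdsimplex RR m) -> R) l :
  sd_at s F (map (comb p) l) = sd_at (subsimplex h) (F \o map (comb p)) l.
Proof. by apply: fine_sd_map; [| apply: stop_at_subsimplex | apply: bary_subsimplex]. Qed.

Lemma htp_at_subsimplex (F : seq (stdsimplex RR m) -> R) l :
  htp_at s F (map (comb p) l) = htp_at (subsimplex h) (F \o map (comb p)) l.
Proof. by apply: fine_htp_map; [| apply: stop_at_subsimplex | apply: bary_subsimplex]. Qed.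

End Naturality.

Lemma lin_sum (T : Type) (L : (T -> R) -> R) :
  (forall a F F', L (fun u => a * F u + F' u) = a * L F + L F') ->
  forall (I : Type) (r : seq I) (P : pred I) (a : I -> R) (F : I -> T -> R),
  L (fun u => \sum_(i <- r | P i) a i * F i u) = \sum_(i <- r | P i) a i * L (F i).
Proof.
move=> Llin I r P a F; elim: r => [|i r IH].
  rewrite big_nil; transitivity (-1 * L (fun=> 0) + L (fun=> 0)); last by ring.
  by rewrite -Llin; congr L; apply/funext => u; rewrite big_nil; ring.
rewrite big_cons -IH; case: ifP => Pi.
  by rewrite -Llin; congr L; apply/funext => u; rewrite big_cons Pi.
by congr L; apply/funext => u; rewrite big_cons Pi.
Qed.

Local Notation n := (fdim X).
(** Functions on full cells: e is the set of factors containing the apex, and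
    the vertices are all those of the simplex. *)
Definition full_cell_fun := {set 'I_n.+1} -> simplex_fun RR R X.
Implicit Types (G : full_cell_fun) (e : {set 'I_n.+1}).

Definition apex_sign (e : {set 'I_n.+1}) (i : 'I_n.+1) : R :=
  (-1) ^+ (#|[set j in e | (j < i)%N]| + i)%N.

(** The normalised coboundary.  The last index is excluded since the last factor
    of the blow-up is not a cone; in this way the pairs with the last index in e
    do not interact with the cells. *)
Definition cobd_full G : full_cell_fun := fun e m s =>
  bd (ev (G e) s) (verts RR m) +
  (-1) ^+ m.+1 * \sum_(i in (e :\ ord_max)%SET) apex_sign e i * G (e :\ i)%SET m s.

Definition sd_full G : full_cell_fun := fun e m s => sd_at s (ev (G e) s) (verts RR m).
Definition htp_full G : full_cell_fun := fun e m s => htp_at s (ev (G e) s) (verts RR m).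

Section EvalOps.
Variables (m : nat) (s : fsimplex RR X m).
Implicit Type l : seq (stdsimplex RR m).

Lemma ev_cobd_full G e l : admissible s l -> ev (cobd_full G e) s l =
  bd (ev (G e) s) l +
  (-1) ^+ size l * \sum_(i in (e :\ ord_max)%SET) apex_sign e i * ev (G (e :\ i)%SET) s l.
Proof.
move=> /admissibleP[k [p [-> h]]]; rewrite ev_mkseq (ev_pointsE _ h) /cobd_full size_mkseq.
congr (_ + _ * _).
  rewrite -map_comb_verts bd_map; apply: eq_bd => u _ /=.
  exact: ev_subsimplex.
by apply: eq_bigr => i _; rewrite ev_mkseq (ev_pointsE _ h).
Qed.

Lemma ev_sd_full G e l : admissible s l -> ev (sd_full G e) s l = sd_at s (ev (G e) s) l.
Proof.
move=> /admissibleP[k [p [-> h]]]; rewrite ev_mkseq (ev_pointsE _ h) /sd_full.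
rewrite -map_comb_verts (sd_at_subsimplex h); congr (sd_at _ _ _).
by apply/funext => u; rewrite ev_subsimplex.
Qed.

Lemma ev_htp_full G e l : admissible s l -> ev (htp_full G e) s l = htp_at s (ev (G e) s) l.
Proof.
move=> /admissibleP[k [p [-> h]]]; rewrite ev_mkseq (ev_pointsE _ h) /htp_full.
rewrite -map_comb_verts (htp_at_subsimplex h); congr (htp_at _ _ _).
by apply/funext => u; rewrite ev_subsimplex.
Qed.

Lemma admissible_facet l1 l : facet l1 l -> admissible s l -> l1 = [::] \/ admissible s l1.
Proof.
move=> f /andP[l0 sl]; have [->|l10] := eqVneq l1 [::]; first by left.
by right; rewrite /admissible l10 (sorted_facet f).
Qed.

Lemma bd_sd_full G e : bd (ev (sd_full G e) s) (verts RR m) =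
  bd (sd_at s (ev (G e) s)) (verts RR m).
Proof.
apply: eq_bd => l1 /admissible_facet /(_ (admissible_verts s)) [->|a1].
  by rewrite sd_at_stop.
exact: ev_sd_full.
Qed.

Lemma bd_htp_full G e : bd (ev (htp_full G e) s) (verts RR m) =
  bd (htp_at s (ev (G e) s)) (verts RR m).
Proof.
apply: eq_bd => l1 /admissible_facet /(_ (admissible_verts s)) [->|a1].
  by rewrite htp_at_stop.
exact: ev_htp_full.
Qed.

(** The apex part of the coboundary only changes e, and the sign in front of it
    depends on the number of vertices, which sd preserves. *)
Lemma sd_full_cobd G e : sd_full (cobd_full G) e s = cobd_full (sd_full G) e s.
Proof.
rewrite /sd_full {2}/cobd_full bd_sd_full -sd_at_bd.
have Slin := fun a F F' => sd_at_lin s a F F' (verts RR m).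
rewrite -(lin_sum Slin (index_enum 'I_n.+1)
  (fun i => i \in (e :\ ord_max)%SET) (apex_sign e)
  (fun i => ev (G (e :\ i)%SET) s)) addrC -sd_at_lin.
apply: sd_at_ext => [|l' [a' _ _] sz _]; first exact: admissible_verts.
by rewrite ev_cobd_full // sz size_verts addrC.
Qed.

(** The pieces of T have one vertex more, so the apex parts of the two summands
    have opposite signs and cancel. *)
Lemma htp_full_homotopy G e :
  htp_full (cobd_full G) e s + cobd_full (htp_full G) e s = G e m s - sd_full G e s.
Proof.
rewrite {2}/cobd_full bd_htp_full -[G e m s]ev_verts -htp_at_homotopy addrA addrAC.
congr (_ + _).
have Hlin := fun a F F' => htp_at_lin s a F F' (verts RR m).
rewrite -[X in _ + _ * X](lin_sum Hlin (index_enum 'I_n.+1)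
  (fun i => i \in (e :\ ord_max)%SET) (apex_sign e)
  (fun i => ev (G (e :\ i)%SET) s)) addrC -htp_at_lin.
apply: htp_at_ext => [|l' [a' _ _] sz]; first exact: admissible_verts.
rewrite ev_cobd_full // sz size_verts [(-1) ^+ m.+2]exprS mulN1r mulNr addrCA subrr.
by rewrite addr0.
Qed.

End EvalOps.
End Cover.

(** * Families of blow-up cochains as functions on full cells *)

Section EnumSet.
Variables (R : comPzRingType) (m : nat).
Implicit Types (F : {set 'I_m}) (K : seq 'I_m -> R).

Lemma enum_sub F (q : pred 'I_m) :
  enum [set w in F | q w]%SET = seq.filter q (enum F).
Proof.
rewrite /enum_mem -filter_predI; apply: eq_filter => w.
by rewrite /= !inE andbC.
Qed.

Lemma enum_setD1 F v : enum (F :\ v)%SET = seq.filter (predC1 v) (enum F).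
Proof.
by rewrite -enum_sub; apply: eq_enum => w; rewrite !inE andbC.
Qed.

Let lt_ord : rel 'I_m := fun v w => (v < w)%N.

Lemma pairwise_enum F : pairwise lt_ord (enum F).
Proof.
rewrite -sorted_pairwise; last by move=> ? ? ?; apply: ltn_trans.
rewrite {1}/enum_mem; apply: sorted_filter; first by move=> ? ? ?; apply: ltn_trans.
have := iota_ltn_sorted 0 m.
by rewrite -val_enum_ord sorted_map enumT.
Qed.

Lemma bd_pairwise K l : pairwise lt_ord l ->
  bd K l = \sum_(v <- l) (-1) ^+ count (lt_ord^~ v) l * K (seq.filter (predC1 v) l).
Proof.
elim: l K => [|x l IH] K /=; first by rewrite big_nil.
move=> /andP[/allP xl pl]; rewrite big_cons IH //.
have xnl : x \notin l by apply/negP => /xl; rewrite /lt_ord ltnn.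
rewrite /= eqxx /= /lt_ord ltnn add0n.
have -> : count (fun w : 'I_m => (w < x)%N) l = 0%N.
  apply/eqP; rewrite -leqn0 leqNgt -has_count; apply/hasPn => w /xl.
  by rewrite /lt_ord -leqNgt => /ltnW.
rewrite mul1r (all_filterP _); last first.
  by apply/allP => w wl /=; apply: contraNneq xnl => <-.
congr (_ + _); rewrite -sumrN; apply: eq_big_seq => v vl.
have xv := xl _ vl; rewrite /lt_ord in xv; rewrite xv /= exprS mulN1r mulNr.
by have -> : (x == v) = false by apply/negbTE; apply: contraNneq xnl => ->.
Qed.

Lemma bd_enum K F : bd K (enum F) =
  \sum_(v in F) (-1) ^+ #|[set w in F | (w < v)%N]%SET| * K (enum (F :\ v)%SET).
Proof.
rewrite bd_pairwise ?pairwise_enum // big_enum /=; apply: eq_bigr => v _.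
by rewrite enum_setD1 cardE enum_sub size_filter.
Qed.

Lemma lt_ord_enum F (s : seq 'I_m) : pairwise lt_ord s -> s =i F -> s = enum F.
Proof.
move=> ps sF; apply: (@irr_sorted_eq _ lt_ord).
- by move=> ? ? ?; apply: ltn_trans.
- by move=> ?; apply: ltnn.
- by rewrite sorted_pairwise //; move=> ? ? ?; apply: ltn_trans.
- rewrite sorted_pairwise ?pairwise_enum //.
  by move=> ? ? ?; apply: ltn_trans.
by move=> v; rewrite sF mem_enum.
Qed.

End EnumSet.

Lemma enum_lift m (v : 'I_m.+2) (F : {set 'I_m.+1}) :
  enum (lift v @: F)%SET = map (lift v) (enum F).
Proof.
symmetry; apply: lt_ord_enum => [|w].
  rewrite pairwise_map; apply: sub_pairwise (pairwise_enum F) => x y /=.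
  by rewrite !ltnNge /= leq_bump2.
apply/mapP/imsetP => [[x]|[x xF ->]]; first by rewrite mem_enum => xF ->; exists x.
by exists x => //; rewrite mem_enum.
Qed.

Section Faces.
Variables (RR : realType) (R : comPzRingType) (X : filtered_space).
Local Notation n := (fdim X).
Implicit Types (G : full_cell_fun RR R X).

Definition face_list m (F : {set 'I_m.+1}) : seq (stdsimplex RR m) :=
  map (@vertex RR m) (enum F).

Lemma face_list_setT m : face_list (finset.setT : {set 'I_m.+1}) = verts RR m.
Proof. by rewrite /face_list /verts; congr map; apply: eq_enum => v; rewrite !inE. Qed.

Lemma size_face_list m (F : {set 'I_m.+1}) : size (face_list F) = #|F|.
Proof. by rewrite size_map -cardE. Qed.

Section OneSimplex.
Variables (m : nat) (s : fsimplex RR X m).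
Implicit Types (F : {set 'I_m.+1}) (e : {set 'I_n.+1}).

Lemma admissible_face_list F : F != finset.set0 -> admissible s (face_list F).
Proof.
move=> F0; apply/andP; split.
  by rewrite -size_eq0 size_face_list cards_eq0.
have /andP[_] := admissible_verts s; apply: subseq_sorted; first exact: leq_trans.
apply: map_subseq; apply: map_subseq; rewrite /enum_mem.
by rewrite [X in subseq _ X](eq_filter (a2 := predT)) // filter_predT filter_subseq.
Qed.

Definition legal_list e l : bool :=
  (ord_max \notin e) &&
  [forall i : 'I_n.+1, (i \in e) || has (fun x => point_level s x == i) l].

Lemma legal_face_list F e : legal (lab s) F e = legal_list e (face_list F).
Proof.
rewrite /legal /legal_list; congr (_ && _); apply: eq_forallb => i; congr (_ || _).
apply/set0Pn/hasP => [[v]|[_ /mapP[v vF ->]]].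
  rewrite inE => /andP[vF /eqP vi]; exists (vertex RR v).
    by apply: map_f; rewrite mem_enum.
  by rewrite -lab_vertex vi.
rewrite mem_enum in vF; rewrite -lab_vertex => /eqP vi; exists v.
by rewrite inE vF; apply/eqP/val_inj.
Qed.

Lemma legal_neq0 F e : legal (lab s) F e -> F != finset.set0.
Proof.
move=> /andP[em /forallP/(_ ord_max)]; rewrite (negbTE em) /=.
by case/set0Pn => v; rewrite inE => /andP[vF _]; apply/set0Pn; exists v.
Qed.

End OneSimplex.

(** G vanishes on the pairs that are not cells.  With this convention facets that
    leave the blow-up need no special treatment. *)
Definition supported G : Prop := forall e m (s : fsimplex RR X m),
  ~~ legal (lab s) finset.setT e -> G e m s = 0.

Lemma ev_supported G e m (s : fsimplex RR X m) l :
  supported G -> ~~ legal_list s e l -> ev (G e) s l = 0.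
Proof.
move=> sG nl; have [al|] := boolP (admissible s l); last exact: ev_not_admissible.
have [k [p [lp h]]] := admissibleP al; rewrite lp ev_mkseq (ev_pointsE _ h); apply: sG.
apply: contra nl => /andP[em /forallP H]; rewrite /legal_list em /=.
apply/forallP => i; have /orP[->//|/set0Pn[v]] := H i.
rewrite inE => /andP[_ /eqP vi]; apply/orP; right; apply/hasP; exists (p v).
  by rewrite lp; apply: map_f; rewrite mem_iota /=.
by rewrite -(subsimplex_labE s p v) -vi.
Qed.

Lemma legal_list_hull m (s : fsimplex RR X m) e l l' :
  (forall x, x \in l' -> hull l x) -> legal_list s e l' -> legal_list s e l.
Proof.
move=> hl /andP[em /forallP H]; rewrite /legal_list em /=; apply/forallP => i.
have /orP[->//|/hasP[x /hl/(point_level_hull s)[y yl ->] xi]] := H i.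
by apply/orP; right; apply/hasP; exists y.
Qed.

Lemma supported_cobd_full G : supported G -> supported (cobd_full G).
Proof.
move=> sG e m s nl; rewrite /cobd_full bd_eq0 ?add0r => [|l1 l1v].
  rewrite big1 ?mulr0 // => i; rewrite !inE => /andP[im ie].
  rewrite sG ?mulr0 //; apply: contra nl => /andP[em /forallP H].
  move: em; rewrite !inE eq_sym (negbTE im) /= => em; rewrite /legal em /=.
  by apply/forallP => j; have := H j; rewrite !inE; case: (j \in e); rewrite ?andbF.
apply: ev_supported => //; apply: contra nl => l1e.
rewrite legal_face_list face_list_setT; apply: legal_list_hull l1e => x /(facet_subset l1v).
exact: hull_mem.
Qed.

Section Ops.
Variable U : set (set X).
Hypothesis coverU : is_open_cover U.

Lemma supported_sd_full G : supported G -> supported (sd_full coverU G).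
Proof.
move=> sG e m s nl; apply: sd_at_eq0; first exact: admissible_verts.
move=> l' [_ hl' _] _ _; apply: ev_supported => //.
by apply: contra nl => /(legal_list_hull hl'); rewrite legal_face_list face_list_setT.
Qed.

Lemma supported_htp_full G : supported G -> supported (htp_full coverU G).
Proof.
move=> sG e m s nl; apply: htp_at_eq0; first exact: admissible_verts.
move=> l' [_ hl' _] _; apply: ev_supported => //.
by apply: contra nl => /(legal_list_hull hl'); rewrite legal_face_list face_list_setT.
Qed.

End Ops.

Definition norm_sign m (la : {ffun 'I_m.+1 -> 'I_n.+1}) F e : R := (-1) ^+ norm_exp la F e.

Section Representation.
Variables (m : nat) (s : fsimplex RR X m) (G : full_cell_fun RR R X).
Local Notation la := (lab s).

(** The cochain whose coordinate at a cell with vertex set F is, up to the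
    normalising sign, the value of G on the face F of s. *)
Definition blowup_of : blowup R la := [ffun c : cell la =>
  norm_sign la (cell_verts la (val c)) (cell_apexes (val c)) *
  ev (G (cell_apexes (val c))) s (face_list (cell_verts la (val c)))].

Hypothesis sG : supported G.

Lemma extend_blowup_of F e :
  extend blowup_of F e = norm_sign la F e * ev (G e) s (face_list F).
Proof.
have [h|h] := boolP (legal la F e).
  by rewrite (extendE _ h) ffunE val_mkcell cell_verts_cell_fun cell_apexes_cell_fun.
by rewrite extend0 // ev_supported ?mulr0 // -legal_face_list.
Qed.

Lemma signr_oddE a b : odd a = odd b -> (-1) ^+ a = (-1) ^+ b :> R.
Proof. by move=> ab; rewrite -signr_odd ab signr_odd. Qed.

Lemma norm_sign_sqr F e : norm_sign la F e * norm_sign la F e = 1.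
Proof. by rewrite /norm_sign -exprD addnn -signr_odd odd_double. Qed.

End Representation.

(** The Koszul signs of the tensor differential on both sides are absorbed by
    the normalising signs, which is what [norm_sign] was chosen for. *)
Lemma blowup_diff_blowup_of m (s : fsimplex RR X m) G : supported G ->
  blowup_diff (blowup_of s G) = blowup_of s (cobd_full G).
Proof.
move=> sG; apply/ffunP => d.
have h := legal_cell d; rewrite -{1}(mkcellK h) blowup_diffE ffunE.
set F := cell_verts _ _ in h *; set e := cell_apexes _ in h *.
rewrite ev_cobd_full; last by apply: admissible_face_list; apply: legal_neq0 h.
have -> : (e :\ ord_max = e)%SET.
  apply/finset.setDidPl; rewrite disjoint_sym disjoints1.
  by have /andP[] := h.
rewrite mulrDr bd_map bd_enum size_face_list; congr (_ + _).
  rewrite mulr_sumr; apply: eq_bigr => v vF.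
  rewrite extend_blowup_of // mulrA -[face_list (F :\ v)%SET]/(map _ _) /=.
  have [h'|h'] := boolP (legal (lab s) (F :\ v)%SET e); last first.
    by rewrite (ev_supported sG) ?mulr0 // -legal_face_list.
  rewrite mulrA; congr (_ * _); rewrite /norm_sign -!exprD; apply: signr_oddE.
  rewrite oddD [RHS]oddD -(vertex_sign _ vF h h'); last exact: lab_homo.
  move: (norm_exp _ _ _) (norm_exp _ (F :\ v)%SET _) (vertex_exp _ _ _ _) => z y x.
  by rewrite !oddD -!addbA [RHS]addbCA addKb.
rewrite !mulr_sumr; apply: eq_bigr => i ie.
rewrite extend_blowup_of // mulrA.
have [h'|h'] := boolP (legal (lab s) F (e :\ i)%SET); last first.
  by rewrite (ev_supported sG) ?mulr0 // -legal_face_list.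
rewrite !mulrA; congr (_ * _); rewrite /norm_sign /apex_sign -!exprD; apply: signr_oddE.
rewrite -addnA [RHS]oddD -(apex_sign_parity ie h h').
move: (norm_exp _ _ _) (norm_exp _ _ (e :\ i)%SET) (apex_exp _ _ _ _) => z y x.
by rewrite !oddD -!addbA [RHS]addbCA addKb.
Qed.

Definition family_of (A : simplex_class RR X) G : cochain_family R A :=
  fun m s _ => blowup_of s G.

Arguments family_of : clear implicits.

Lemma coboundary_family_of A G : supported G ->
  coboundary (family_of A G) = family_of A (cobd_full G).
Proof. by move=> sG; apply: Defs.familyP => m s As; apply: blowup_diff_blowup_of. Qed.

(** Inverse of [family_of], by [family_of_full_values] and
    [full_values_family_of]. *)
Definition full_values (A : simplex_class RR X) (w : cochain_family R A) :
    full_cell_fun RR R X := fun e m s =>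
  if pselect (A m s) is left As then
    norm_sign (lab s) finset.setT e * extend (w m s As) finset.setT e
  else 0.

Lemma full_valuesE A (w : cochain_family R A) e m s (As : A m s) :
  full_values w e s = norm_sign (lab s) finset.setT e * extend (w m s As) finset.setT e.
Proof.
rewrite /full_values; case: pselect => // As'.
by rewrite (Prop_irrelevance As As').
Qed.

Lemma full_values_out A (w : cochain_family R A) e m s : ~ A m s -> full_values w e s = 0.
Proof. by rewrite /full_values; case: pselect. Qed.

Lemma supported_full_values A (w : cochain_family R A) : supported (full_values w).
Proof.
move=> e m s nl; have [As|nAs] := pselect (A m s); last exact: full_values_out.
by rewrite (full_valuesE _ _ As) extend0 ?mulr0.
Qed.

Section LiftedCell.
Variables (m : nat) (s : fsimplex RR X m.+1) (v : 'I_m.+2).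
Local Notation la := (lab s).
Variable c : cell (face_lab v la).
Definition lifted : cell la := Sub _ (face_cellP c).

Lemma cell_apexes_lifted : cell_apexes (val lifted) = cell_apexes (val c).
Proof. by apply/setP => i; rewrite !inE SubK ffunE. Qed.

Lemma cell_verts_lifted : cell_verts la (val lifted) =
  (lift v @: cell_verts (face_lab v la) (val c))%SET.
Proof.
apply/setP => w; rewrite inE SubK ffunE /=.
apply/imsetP/imsetP => -[x xc wx]; exists x => //; move: xc; rewrite inE wx ffunE //.
Qed.

Lemma card_label_part_lifted i :
  #|label_part la (cell_verts la (val lifted)) i| =
  #|label_part (face_lab v la) (cell_verts (face_lab v la) (val c)) i|.
Proof.
rewrite cell_verts_lifted -(card_imset _ (@lift_inj _ v)); apply: eq_card => w.
rewrite inE; apply/andP/imsetP => [[/imsetP[x xc ->] xi]|[x]].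
  by exists x => //; rewrite inE xc ffunE.
by rewrite inE ffunE => /andP[xc xi] ->; split=> //; apply: imset_f.
Qed.

Lemma norm_sign_lifted e : norm_sign la (cell_verts la (val lifted)) e =
  norm_sign (face_lab v la) (cell_verts (face_lab v la) (val c)) e.
Proof.
rewrite /norm_sign /norm_exp; congr (_ ^+ _); apply: eq_bigr => i _.
by rewrite card_label_part_lifted.
Qed.

Lemma ev_lifted (g : simplex_fun RR R X) :
  ev g s (face_list (cell_verts la (val lifted))) =
  ev g (face v s) (face_list (cell_verts (face_lab v la) (val c))).
Proof.
pose p i := vertex RR (lift v (inord i : 'I_m.+1)).
have h : level_nondec s m p.
  move=> i j ij jm; rewrite /p -!lab_vertex; apply: lab_homo.
  by rewrite /= leq_bump2 !inordK // ltnS // (leq_trans ij).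
have -> : face v s = subsimplex h.
  apply: fsimplex_eq => t /=; congr (s _); apply: val_inj => /=.
  apply/rowP => w; rewrite !mxE.
  case: unliftP => [u ->|->].
    have pE (j : 'I_m.+1) : points_mx m p j (lift v u) = (u == j)%:R.
      by rewrite !mxE inord_val /= (inj_eq lift_inj).
    rewrite (bigD1 u) //= pE eqxx mulr1 big1 ?addr0 // => j ju.
    by rewrite pE eq_sym (negbTE ju) mulr0.
  rewrite big1 // => j _; rewrite !mxE /= (negbTE (neq_lift _ _)).
  by rewrite mulr0.
rewrite ev_subsimplex; congr (ev _ _ _).
rewrite /face_list cell_verts_lifted enum_lift -!map_comp.
by apply: eq_map => u /=; rewrite comb_vertex /p inord_val.
Qed.

End LiftedCell.

Lemma compatible_family_of A G : compatible (family_of A G).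
Proof.
move=> m s v As Al; apply/ffunP => c; rewrite !ffunE.
rewrite -[Sub _ _]/(lifted c).
by rewrite norm_sign_lifted cell_apexes_lifted ev_lifted.
Qed.

Definition face_closed (A : simplex_class RR X) : Prop :=
  forall m (s : fsimplex RR X m.+1) v, A _ s -> is_regular (face v s) -> A _ (face v s).

(** Compatibility moves the value at any cell to the simplex spanned by the
    vertices of that cell, one omitted vertex at a time. *)
Lemma family_of_full_values A (w : cochain_family R A) : face_closed A -> compatible w ->
  family_of A (full_values w) = w.
Proof.
move=> fA cw; apply: Defs.familyP => m s As; apply/ffunP => c.
elim: m s As c => [|m IH] s As c.
  have F1 : cell_verts (lab s) (val c) = finset.setT.
    have /set0Pn[v vF] := legal_neq0 (legal_cell c).
    apply/setP => x; have -> : x = v by rewrite [x]ord1 [v]ord1.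
    by rewrite vF finset.in_setT.
  rewrite ffunE F1 face_list_setT ev_verts (full_valuesE _ _ As) mulrA norm_sign_sqr mul1r.
  by rewrite -{1}F1 extend_val.
have [F1|F1] := eqVneq (cell_verts (lab s) (val c)) finset.setT.
  rewrite ffunE F1 face_list_setT ev_verts (full_valuesE _ _ As) mulrA norm_sign_sqr mul1r.
  by rewrite -{1}F1 extend_val.
have [v vF] : exists v, v \notin cell_verts (lab s) (val c).
  apply/existsP; apply: contraNT F1; rewrite negb_exists => /forallP H.
  by apply/eqP/setP => x; rewrite !inE; have := H x; rewrite negbK inE.
(* c comes from a cell of the facet opposite to the vertex v outside c. *)
pose F' := [set x | lift v x \in cell_verts (lab s) (val c)]%SET.
have FF' : (lift v @: F')%SET = cell_verts (lab s) (val c).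
  apply/setP => x; apply/imsetP/idP => [[y yF ->]|xF]; first by rewrite inE in yF.
  have [y xy|xv] := unliftP v x; first by exists y => //; rewrite inE -xy.
  by rewrite xv (negbTE vF) in xF.
have pF' i : (label_part (face_lab v (lab s)) F' i != finset.set0) =
    (label_part (lab s) (cell_verts (lab s) (val c)) i != finset.set0).
  apply/set0Pn/set0Pn => -[x].
    rewrite inE ffunE => /andP[xF xi]; exists (lift v x).
    by move: xF; rewrite !inE xi => ->.
  rewrite inE -FF' => /andP[/imsetP[y yF ->] yi]; exists y.
  by rewrite inE yF ffunE.
have [e0 e0E] : exists e0, e0 = cell_apexes (val c) by exists (cell_apexes (val c)).
have h' : legal (face_lab v (lab s)) F' e0.
  have := legal_cell c; rewrite /legal -e0E => /andP[-> /forallP H] /=.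
  by apply/forallP => i; rewrite pF'.
have cE : lifted (mkcell h') = c.
  apply: val_inj; rewrite -(cell_funK (lifted _)) -(cell_funK c).
  rewrite cell_apexes_lifted cell_verts_lifted.
  by rewrite val_mkcell cell_verts_cell_fun cell_apexes_cell_fun FF' e0E.
have rf : is_regular (face v s).
  have /andP[em /forallP/(_ ord_max)] := h'; rewrite (negbTE em) /=.
  by case/set0Pn => x; rewrite inE => /andP[_ /eqP xn]; exists x.
have Al := fA _ _ _ As rf.
have restr (w' : cochain_family R A) : compatible w' ->
    w' m.+1 s As c = w' m (face v s) Al (mkcell h').
  move=> cw'; move: (cw' m s v As Al) => /ffunP/(_ (mkcell h')) <-.
  by rewrite ffunE -[Sub _ _]/(lifted (mkcell h')) cE.
by rewrite (restr _ cw) -IH (restr _ (@compatible_family_of A (full_values w))).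
Qed.

End Faces.

Arguments family_of {RR R X} A G m s As.

(** * Degrees, allowability and supports *)

(** Bounded non-empty sets of integers have a largest element; this makes the
    supremum in the definition of the perverse degree a true one. *)
Lemma supremums_ereal_int (A : set (\bar int)) : supremums A !=set0.
Proof.
have [[b bA]|nob] := pselect (exists b : int, ubound A b%:E); last first.
  exists +oo%E; split=> [x _|u uA]; first exact: leey.
  case: u uA => [r rA| // |nA]; first by case: nob; exists r.
  by case: nob; exists 0 => x /nA xn; apply: le_trans xn _; apply: leNye.
have [[z zA]|noz] := pselect (exists z : int, A z%:E); last first.
  exists -oo%E; split=> [x Ax|u _]; last exact: leNye.
  case: x Ax => [r rA|/bA|]; [by case: noz; exists r| |by []].
  by rewrite leye_eq.
pose P k := `[< ubound A (z + k%:Z)%:E >].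
have Pge (r : int) : ubound A r%:E -> P `|r - z|%N /\ z <= r.
  move=> rA; have zr : z <= r by have := rA _ zA; rewrite lee_fin.
  split=> //; apply/asboolP; rewrite gez0_abs ?subr_ge0 //.
  by have -> : z + (r - z) = r by ring.
have exP : exists k, P k by exists `|b - z|%N; have [] := Pge _ bA.
have [k /asboolP kA kmin] := ex_minnP exP.
exists (z + k%:Z)%:E; split=> // u uA.
case: u uA => [r rA|_|/(_ _ zA) //]; last exact: leey.
have [Pr zr] := Pge _ rA; rewrite lee_fin -lerBrDl.
by rewrite -(@gez0_abs (r - z)) ?subr_ge0 // lez_nat kmin.
Qed.

Section Strata.
Variables (RR : realType) (X : filtered_space) (m : nat) (s : fsimplex RR X m).
Implicit Types (x y : stdsimplex RR m).

Lemma pure_partP (z : X) i : @pure_part X i z <-> level z = i.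
Proof.
rewrite /pure_part /pred_skeleton; case: i => [|i].
  split=> [[/levelP]|<-]; first by rewrite leqn0 => /eqP.
  by split=> //; apply/levelP.
split=> [[/levelP zi] /levelP|e].
  by move/negP; rewrite -ltnNge => iz; apply/eqP; rewrite eqn_leq zi.
split; first by apply/levelP; rewrite e.
by move=> /levelP; rewrite e ltnn.
Qed.

(** The points of a simplex with a given level form a convex, hence connected,
    subset, so they all go to the same stratum. *)
Lemma same_stratum (S : stratum X) x y :
  stratum_set S (s y) -> point_level s x = stratum_index S -> stratum_set S (s x).
Proof.
have [x0 Px0 SE] := stratumP S; rewrite SE => Sy xi.
have yi : point_level s y = stratum_index S.
  by apply/pure_partP; apply: connected_component_sub Sy.
rewrite (same_connected_component Sy).
(* A path from y to x defined on the whole line, constant outside [0, 1]. *)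
pose clamp (t : RR) : RR := Order.min 1 (Order.max 0 t).
have c0 t : 0 <= clamp t by rewrite le_min ler01 le_max lexx.
have c1 t : clamp t <= 1 by rewrite ge_min lexx.
pose g t := to_point (convex_stdsimplex (c0 t) (c1 t) (pointP x) (pointP y)).
have gc : continuous g.
  apply: continuous_comp_initial => t /=.
  have cc : {for t, continuous clamp}.
    apply: continuous_min; first exact: cvg_cst.
    by apply: continuous_max; [exact: cvg_cst | exact: cvg_id].
  apply: (@cvgD _ _ _ (nbhs t) _ (fun t => clamp t *: val x)
    (fun t => (1 - clamp t) *: val y)).
    exact: cvgZr_tmp.
  by apply: cvgZr_tmp; apply: cvgB => //; apply: cvg_cst.
have gi t : point_level s (g t) = stratum_index S.
  have hg : hull [:: x; y] (g t).
    move=> C cC Cl /=; apply: (cC) => //; apply: Cl; rewrite !inE eqxx ?orbT //.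
  by have [z] := point_level_hull s hg; rewrite !inE => /orP[] /eqP -> ->.
have g1 : g 1 = x.
  apply: val_inj => /=; rewrite /clamp max_r ?ler01 // minxx.
  by rewrite scale1r subrr scale0r addr0.
have g0 : g 0 = y.
  apply: val_inj => /=; rewrite /clamp maxxx min_r ?ler01 //.
  by rewrite scale0r subr0 scale1r add0r.
apply: (@connected_component_max _ _ ((s \o g) @` setT)).
- by exists 0 => //=; rewrite g0.
- by move=> _ [t _ <-]; apply/pure_partP; apply: gi.
- apply: connected_continuous_connected; first by apply/connected_intervalP.
  apply: continuous_subspaceT => t; apply: continuous_comp; first exact: gc.
  exact: fsimplex_continuous.
by exists 1 => //=; rewrite g1.
Qed.

Lemma stratum_index_le (S : stratum X) : (stratum_index S <= fdim X)%N.
Proof.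
have [x0 /pure_partP <- _] := stratumP S; exact: level_le.
Qed.

End Strata.

Section Norms.
Variables (RR : realType) (R : comPzRingType) (X : filtered_space).
Local Notation n := (fdim X).

Lemma allowableP (p : perversity X) (A : simplex_class RR X) (w : cochain_family R A) :
  allowable p w <-> forall (S : stratum X), (0 < codim S)%N ->
    forall m s (As : A m s), range s `&` S !=set0 ->
    forall c, w m s As c != 0 -> (cell_norm (codim S) c <= p S)%E.
Proof.
split=> [H S S0 m s As sS c wc|H S S0].
  apply: le_trans (H S S0).
  apply: (@le_trans _ _ (blowup_norm (codim S) (w m s As))).
    by rewrite /blowup_norm; apply: (@le_bigmax_cond _ _ _ _ c).
  apply: ge_supremum_Nmem; first exact: supremums_ereal_int.
  by exists m, s, As.
rewrite /perverse_degree; set E := [set _ | _].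
have ubE : ubound E (p S).
  move=> _ [m [s [As [sS ->]]]]; apply/bigmax_leP; split; first exact: leNye.
  by move=> c wc; apply: H wc.
rewrite /supremum; case: ifPn => [_|E0]; first exact: leNye.
by case: xgetP => [y _ [_ lb]|_]; [apply: lb | apply: leNye].
Qed.

Lemma sum_label_part m (s : fsimplex RR X m) (F : {set 'I_m.+1}) j :
  (\sum_(i < n.+1 | (j < i)%N) #|label_part (lab s) F i| =
   count_above s j (face_list RR F))%N.
Proof.
rewrite /count_above /face_list count_map -size_filter -enum_sub -cardE -sum1_card.
rewrite [RHS](partition_big (fun v => lab s v) (fun i : 'I_n.+1 => j < i)%N) /=.
  apply: eq_bigr => i ji; rewrite -sum1_card; apply: eq_bigl => v.
  rewrite !inE -lab_vertex; case: (eqVneq (lab s v) i) => [->|]; last by rewrite !andbF.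
  by rewrite ji !andbT.
by move=> v; rewrite inE -lab_vertex => /andP[].
Qed.

Lemma count_above_subsimplex m (s : fsimplex RR X m) k q (h : level_nondec s k q) j :
  count_above (subsimplex h) j (verts RR k) = count_above s j (mkseq q k.+1).
Proof. by rewrite -map_comb_verts /count_above count_map. Qed.

(** G' only involves values of G at refinements having d vertices more; here e
    is unchanged.  Degrees, allowability and supports pass from G to G'. *)
Definition derived d (G G' : full_cell_fun RR R X) : Prop :=
  forall e m (s : fsimplex RR X m) l, admissible s l -> ev (G' e) s l != 0 ->
  exists l', [/\ refines s l l', size l' = (size l + d)%N & ev (G e) s l' != 0].

Lemma derived_sd_full U (cU : is_open_cover U) G : derived 0 G (sd_full cU G).
Proof.
move=> e m s l al; rewrite ev_sd_full // => nz; apply: contrapT => H.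
move/eqP: nz; apply; apply: sd_at_eq0 => // l' r sz _; apply/eqP/negPn/negP => nz.
by apply: H; exists l'; rewrite addn0.
Qed.

Lemma derived_htp_full U (cU : is_open_cover U) G : derived 1 G (htp_full cU G).
Proof.
move=> e m s l al; rewrite ev_htp_full // => nz; apply: contrapT => H.
move/eqP: nz; apply; apply: htp_at_eq0 => // l' r sz; apply/eqP/negPn/negP => nz.
by apply: H; exists l'; rewrite addn1.
Qed.

Section Witness.
Variables (A B : simplex_class RR X) (w : cochain_family R A).
Variables (d : nat) (G : full_cell_fun RR R X).
Hypothesis wG : derived d (full_values w) G.

(** A non-zero coordinate of the new family comes from a non-zero coordinate of w
    at a full cell of a simplex inside s, with at least as many vertices above
    each level. *)
Lemma derived_witness m s (Bs : B s) (c : cell (lab s)) :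
  family_of B G m s Bs c != 0 ->
  exists k q (h : level_nondec s k q) (As : A (subsimplex h))
    (c' : cell (lab (subsimplex h))),
  [/\ w As c' != 0, cell_verts (lab (subsimplex h)) (val c') = finset.setT,
      cell_apexes (val c') = cell_apexes (val c),
      k.+1 = (#|cell_verts (lab s) (val c)| + d)%N &
      forall j, (count_above s j (face_list RR (cell_verts (lab s) (val c))) <=
                 count_above (subsimplex h) j (verts RR k))%N].
Proof.
have al := admissible_face_list s (legal_neq0 (legal_cell c)).
rewrite ffunE => nz; have {nz} /(wG al)[l' [[al' _ hi] sz nz]] :
    ev (G (cell_apexes (val c))) s (face_list RR (cell_verts (lab s) (val c))) != 0.
  by apply: contra_neq nz => ->; rewrite mulr0.
have [k [q [lq h]]] := admissibleP al'; move: nz sz hi.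
rewrite lq ev_mkseq (ev_pointsE _ h) size_mkseq size_face_list => nz sz hi.
have [As|nAs] := pselect (A (subsimplex h)); last by rewrite full_values_out ?eqxx in nz.
rewrite (full_valuesE _ _ As) in nz.
have [h'|nh] := boolP (legal (lab (subsimplex h)) finset.setT (cell_apexes (val c)));
  last by rewrite extend0 // mulr0 eqxx in nz.
exists k, q, h, As, (mkcell h'); split=> //.
- by apply: contra_neq nz => e; rewrite (extendE _ h') e mulr0.
- by rewrite val_mkcell cell_verts_cell_fun.
- by rewrite val_mkcell cell_apexes_cell_fun.
by move=> j; rewrite count_above_subsimplex.
Qed.

Lemma vanishes_derived K : vanishes_off K w -> vanishes_off K (family_of B G).
Proof.
move=> wK m s Bs sK; apply/ffunP => c; rewrite [RHS]ffunE; apply/eqP/negPn/negP.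
move=> /derived_witness [k [q [h [As [c' [nz _ _ _ _]]]]]].
move/eqP: nz; apply; rewrite wK ?ffunE //; apply/seteqP; split=> // z [[t _ <-] Kz].
by rewrite -sK; split=> //; exists (comb q t).
Qed.

Lemma cell_dimE m (la : {ffun 'I_m.+1 -> 'I_n.+1}) (c : cell la) :
  (cell_dim c + n.+1 = #|cell_verts la (val c)| + #|cell_apexes (val c)|)%N.
Proof.
have := sum_dim predT (legal_cell c); rewrite cell_funK -card_label_part card_ord => ->.
by congr (_ + _)%N; apply: eq_card => i; rewrite !inE andbT.
Qed.

Lemma of_degree_derived k : of_degree k w -> of_degree (k - d%:Z) (family_of B G).
Proof.
move=> wk m s Bs c /derived_witness [k' [q [h [As [c' [nz Fc ec sz _]]]]]].
have := cell_dimE c'; rewrite Fc ec cardsT card_ord sz => e1.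
have e2 := cell_dimE c; have <- := wk _ _ _ _ nz; lia.
Qed.

(** If the cell c has finite norm with respect to S, the factor of S contains no
    apex, so by legality the label of S occurs among the vertices of the
    witness.  The witness meets the same stratum S as s does, and its norm is at
    least that of c. *)
Lemma allowable_derived p : allowable p w -> allowable p (family_of B G).
Proof.
move=> /allowableP wp; apply/allowableP => S S0 m s Bs [_ [[y _ <-] Sy]] c.
move=> /derived_witness [k [q [h [As [c' [nz Fc ec sz hi]]]]]].
set j : 'I_n.+1 := inord (n - codim S).
have jS : j = stratum_index S :> nat.
  by rewrite /j /codim subKn ?inordK ?ltnS ?stratum_index_le.
have [je|je] := boolP (j \in cell_apexes (val c)).
  by rewrite /cell_norm; move: je; rewrite inE => ->; apply: leNye.
have [v vj] : exists v, lab (subsimplex h) v = j.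
  have := legal_cell c'; rewrite ec => /andP[_ /forallP/(_ j)].
  by rewrite (negbTE je) => /set0Pn[v]; rewrite inE => /andP[_ /eqP]; exists v.
apply: le_trans (wp S S0 _ _ As _ _ nz); last first.
  exists (subsimplex h (vertex RR v)); split; first by exists (vertex RR v).
  rewrite /= comb_vertex; apply: same_stratum Sy _.
  by rewrite -(subsimplex_labE s q v) -[subsimplex_lab s k q v]/(lab (subsimplex h) v) vj.
rewrite /cell_norm -/j; have := je; rewrite inE => /negbTE ->.
have := je; rewrite -ec inE => /negbTE ->.
have -> : (n - codim S = j)%N by rewrite jS /codim subKn ?stratum_index_le.
rewrite lee_fin lez_nat.
have := hi j; rewrite -face_list_setT -!sum_label_part.
have := sum_dim [pred i : 'I_n.+1 | (j < i)%N] (legal_cell c).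
have := sum_dim [pred i : 'I_n.+1 | (j < i)%N] (legal_cell c').
rewrite !cell_funK Fc ec /= => e1 e2 e3.
by rewrite -(leq_add2r #|[pred i : 'I_n.+1 | (j < i)%N]|) e1 e2 leq_add2r.
Qed.

End Witness.

End Norms.

(** * The extension operator and the homotopy *)

Section Assembly.
Variables (RR : realType) (R : comPzRingType) (X : filtered_space).
Variable U : set (set X).
Hypothesis cU : is_open_cover U.
Local Notation n := (fdim X).
Local Notation reg := (regular_simplices RR X).
Local Notation sml := (small_simplices RR U).
Implicit Types (A B : simplex_class RR X) (G : full_cell_fun RR R X).

Lemma face_closed_regular : face_closed reg.
Proof. by move=> m s v _. Qed.

Lemma face_closed_small : face_closed sml.
Proof.
move=> m s v [_ [V UV sV]] rf; split=> //; exists V => // _ [t _ <-].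
by apply: sV; exists (face_incl v t).
Qed.

Lemma legal_regular m (s : fsimplex RR X m) F e : legal (lab s) F e -> is_regular s.
Proof.
move=> /andP[em /forallP/(_ ord_max)]; rewrite (negbTE em) /=.
by case/set0Pn => v; rewrite inE => /andP[_ /eqP sv]; exists v.
Qed.

Lemma stop_at_small m (s : fsimplex RR X m) k p (h : level_nondec s k p) :
  stop_at U s (mkseq p k.+1) -> exists2 V, U V & range (subsimplex h) `<=` V.
Proof.
move=> /(stop_atP cU)[//|[V UV pV]].
exists V => // _ [t _ <-]; apply: pV; apply/hull_comb.
by exists t.
Qed.

Lemma small_stop_at m (s : fsimplex RR X m) l :
  (exists2 V, U V & range s `<=` V) -> stop_at U s l.
Proof.
by move=> [V UV sV]; apply/(stop_atP cU); right; exists V => // x _; apply: sV; exists x.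
Qed.

(** A stopped simplex is small or not regular, and both sides vanish in the
    second case. *)
Lemma ev_small_eq G G' e m (s : fsimplex RR X m) l :
  supported G -> supported G' ->
  (forall k (s' : fsimplex RR X k), sml _ s' -> G e k s' = G' e k s') ->
  stop_at U s l -> ev (G e) s l = ev (G' e) s l.
Proof.
move=> sG sG' GG' sl; have [al|nal] := boolP (admissible s l); last by rewrite !ev_not_admissible.
have [k [p [lp h]]] := admissibleP al; rewrite lp in sl *.
rewrite !ev_mkseq !(ev_pointsE _ h).
have [lg|nlg] := boolP (legal (lab (subsimplex h)) finset.setT e); last first.
  by rewrite sG ?sG'.
by apply: GG'; split; [apply: legal_regular lg | apply: stop_at_small sl].
Qed.

Lemma sd_full_small_eq G G' e m (s : fsimplex RR X m) :
  supported G -> supported G' ->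
  (forall e k (s' : fsimplex RR X k), sml _ s' -> G e k s' = G' e k s') ->
  sd_full cU G e s = sd_full cU G' e s.
Proof.
move=> sG sG' GG'; apply: sd_at_ext => [|l' _ _ sl]; first exact: admissible_verts.
by apply: ev_small_eq => //; apply: GG'.
Qed.

Lemma full_values_family_of A G e m (s : fsimplex RR X m) : supported G -> A m s ->
  full_values (family_of A G) e s = G e m s.
Proof.
move=> sG As; rewrite (full_valuesE _ _ As) extend_blowup_of // mulrA norm_sign_sqr mul1r.
by rewrite face_list_setT ev_verts.
Qed.

Lemma coboundary_full_values A (w : cochain_family R A) : face_closed A -> compatible w ->
  coboundary w = family_of A (cobd_full (full_values w)).
Proof.
move=> fA cw; rewrite -{1}(family_of_full_values fA cw).
by apply: coboundary_family_of; apply: supported_full_values.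
Qed.

Lemma full_values_coboundary A (w : cochain_family R A) e m (s : fsimplex RR X m) :
  face_closed A -> compatible w -> A m s ->
  full_values (coboundary w) e s = cobd_full (full_values w) e s.
Proof.
move=> fA cw As; rewrite (coboundary_full_values fA cw) full_values_family_of //.
by apply: supported_cobd_full; apply: supported_full_values.
Qed.

Lemma full_values_coboundary_regular (w : cochain_family R reg) : compatible w ->
  full_values (coboundary w) = cobd_full (full_values w).
Proof.
move=> cw; apply/funext => e; apply: functional_extensionality_dep => m.
apply/funext => s; have [rs|nrs] := pselect (reg _ s).
  exact: (full_values_coboundary _ face_closed_regular).
rewrite full_values_out // supported_cobd_full //; first exact: supported_full_values.
by apply/negP => /legal_regular.
Qed.

Lemma full_cell_fun_ext G G' : (forall e m s, G e m s = G' e m s) -> G = G'.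
Proof.
move=> GG'; apply/funext => e; apply: functional_extensionality_dep => m.
by apply/funext => s.
Qed.

(** The values of w are extended by 0 to non-small simplices.  This extension
    does not commute with the coboundary, but the subdivision operator only
    reads values at small simplices. *)
Definition phi (w : cochain_family R sml) : cochain_family R reg :=
  family_of reg (sd_full cU (full_values w)).
Definition Theta (w : cochain_family R reg) : cochain_family R reg :=
  family_of reg (htp_full cU (full_values w)).

Lemma phi_coboundary w : compatible w -> phi (coboundary w) = coboundary (phi w).
Proof.
move=> cw; rewrite /phi coboundary_family_of; last first.
  by apply: supported_sd_full; apply: supported_full_values.
congr (family_of reg _); apply: full_cell_fun_ext => e m s; rewrite -sd_full_cobd.
apply: sd_full_small_eq; first exact: supported_full_values.
  by apply: supported_cobd_full; apply: supported_full_values.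
by move=> e' k s' ss'; apply: (full_values_coboundary _ face_closed_small).
Qed.

Lemma restriction_phi w : compatible w -> restriction (phi w) = w.
Proof.
move=> cw; rewrite -[RHS](family_of_full_values face_closed_small cw).
apply: Defs.familyP => m s As; apply/ffunP => c; rewrite !ffunE.
rewrite ev_sd_full; last by apply: admissible_face_list; apply: legal_neq0 (legal_cell c).
by rewrite sd_at_stop //; apply: small_stop_at; case: As.
Qed.

Lemma phi_restriction w : phi (restriction w) = family_of reg (sd_full cU (full_values w)).
Proof.
congr (family_of reg _); apply: full_cell_fun_ext => e m s.
apply: sd_full_small_eq; try exact: supported_full_values.
by move=> e' k s' ss'; rewrite (full_valuesE _ _ ss') (full_valuesE _ _ (proj1 ss')).
Qed.

Lemma Theta_homotopy w : compatible w ->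
  coboundary (Theta w) + Theta (coboundary w) = w - phi (restriction w).
Proof.
move=> cw; rewrite phi_restriction /Theta coboundary_family_of; last first.
  by apply: supported_htp_full; apply: supported_full_values.
rewrite (full_values_coboundary_regular cw).
rewrite -[X in _ = X - _](family_of_full_values face_closed_regular cw).
apply: Defs.familyP => m s As; apply/ffunP => c.
have al := admissible_face_list s (legal_neq0 (legal_cell c)).
have [k [p [lp h]]] := admissibleP al.
rewrite [LHS]ffunE [RHS]ffunE [in RHS]ffunE !ffunE.
rewrite -mulrDr -mulrN -mulrDr; congr (_ * _).
rewrite lp !ev_mkseq !(ev_pointsE _ h) addrC.
exact: htp_full_homotopy.
Qed.

Lemma ev_lin a (g g1 g2 : simplex_fun RR R X) m (s : fsimplex RR X m) l :
  (forall k (s' : fsimplex RR X k), g k s' = a * g1 k s' + g2 k s') ->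
  ev g s l = a * ev g1 s l + ev g2 s l.
Proof.
move=> glin; have [al|nal] := boolP (admissible s l); last first.
  by rewrite !ev_not_admissible // mulr0 addr0.
by have [k [p [-> h]]] := admissibleP al; rewrite !ev_mkseq !(ev_pointsE _ h).
Qed.

Lemma full_values_lin A a (w w' : cochain_family R A) e m (s : fsimplex RR X m) :
  full_values (a *: w + w') e s = a * full_values w e s + full_values w' e s.
Proof.
have [As|nAs] := pselect (A m s); last by rewrite !full_values_out // mulr0 addr0.
rewrite !(full_valuesE _ _ As).
have [h|h] := boolP (legal (lab s) finset.setT e); last first.
  by rewrite !extend0 // !mulr0 addr0.
by rewrite !(extendE _ h) !ffunE mulrDr mulrCA.
Qed.

Lemma family_of_lin A a G G1 G2 :
  (forall e m (s : fsimplex RR X m), G e m s = a * G1 e m s + G2 e m s) ->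
  family_of A G = a *: family_of A G1 + family_of A G2.
Proof.
move=> Glin; apply: Defs.familyP => m s As; apply/ffunP => c; rewrite !ffunE.
by rewrite (ev_lin _ _ (Glin _)) mulrDr mulrCA.
Qed.

Lemma phi_lin a w w' : phi (a *: w + w') = a *: phi w + phi w'.
Proof.
apply: family_of_lin => e m s; rewrite /sd_full -sd_at_lin; congr (sd_at _ _ _ _).
by apply/funext => l; apply: ev_lin => k s'; apply: full_values_lin.
Qed.

Lemma Theta_lin a w w' : Theta (a *: w + w') = a *: Theta w + Theta w'.
Proof.
apply: family_of_lin => e m s; rewrite /htp_full -htp_at_lin; congr (htp_at _ _ _ _).
by apply/funext => l; apply: ev_lin => k s'; apply: full_values_lin.
Qed.

Variable p : perversity X.

Lemma allowable_sub A (w w' : cochain_family R A) :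
  allowable p w -> allowable p w' -> allowable p (w - w').
Proof.
move=> /allowableP aw /allowableP aw'; apply/allowableP => S S0 m s As sS c.
have [wc|wc _] := eqVneq (w m s As c) 0; last exact: aw wc.
have [wc'|wc' _] := eqVneq (w' m s As c) 0; last exact: aw' wc'.
by rewrite !ffunE wc wc' subr0 eqxx.
Qed.

Lemma phi_icochain k w : icochain p k w -> icochain p (k + 0) (phi w).
Proof.
move=> [cw dw aw adw]; split.
- exact: compatible_family_of.
- rewrite addr0 -[k]subr0.
  exact: (of_degree_derived (@derived_sd_full RR R X U cU (full_values w)) dw).
- exact: (allowable_derived reg (@derived_sd_full RR R X U cU (full_values w)) aw).
rewrite -phi_coboundary //.
exact: (allowable_derived reg
  (@derived_sd_full RR R X U cU (full_values (coboundary w))) adw).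
Qed.

(** The coboundary of Theta w is allowable because the homotopy relation
    expresses it by families that are. *)
Lemma Theta_icochain k w : icochain p k w -> icochain p (k + -1) (Theta w).
Proof.
move=> [cw dw aw adw]; split.
- exact: compatible_family_of.
- exact: (of_degree_derived (@derived_htp_full RR R X U cU (full_values w)) dw).
- exact: (allowable_derived reg (@derived_htp_full RR R X U cU (full_values w)) aw).
have -> : coboundary (Theta w) = w - phi (restriction w) - Theta (coboundary w).
  by rewrite -Theta_homotopy // addrK.
apply: allowable_sub; last first.
  exact: (allowable_derived reg
    (@derived_htp_full RR R X U cU (full_values (coboundary w))) adw).
apply: allowable_sub => //; rewrite phi_restriction.
exact: (allowable_derived reg (@derived_sd_full RR R X U cU (full_values w)) aw).
Qed.

End Assembly.

Theorem theorem2 (RR : realType) (R : comPzRingType) (X : filtered_space)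
    (p : perversity X) (U : set (set X)) :
  is_open_cover U ->
  exists (phi : cochain_family R (small_simplices RR U) ->
                cochain_family R (regular_simplices RR X))
         (Theta : cochain_family R (regular_simplices RR X) ->
                  cochain_family R (regular_simplices RR X)),
    [/\ cochain_map p phi,
        graded_linear p (-1) Theta,
        forall k w, icochain p k w -> restriction (phi w) = w,
        forall k w, icochain p k w ->
          coboundary (Theta w) + Theta (coboundary w) = w - phi (restriction w) &
        forall k w (K : set X), icochain p k w ->
          vanishes_off K w -> vanishes_off K (phi w)].
Proof.
move=> cU; exists (phi cU), (Theta cU); split.
- split=> [k|k w [cw _ _ _]]; last exact: phi_coboundary.
  by split=> [w|a w w' _ _]; [apply: phi_icochain | apply: phi_lin].
- by move=> k; split=> [w|a w w' _ _]; [apply: Theta_icochain | apply: Theta_lin].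
- by move=> k w [cw _ _ _]; apply: restriction_phi.
- by move=> k w [cw _ _ _]; apply: Theta_homotopy.
by move=> k w K _; apply: vanishes_derived; apply: derived_sd_full.
Qed.
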